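(* Any $*$-representation $R$ of the category $\mathcal K(G,K)$ is equivalent to the representation $\widetilde\rho$ obtained from some unitary representation $\rho$ of the trisymmetric group $\mathbf G$; moreover, the representation $\rho$ is unique (up to unitary equivalence).
   Context: $S_\infty$ is the group of finitely supported permutations of $\mathbb N=\{1,2,\dots\}$, $\overline S_\infty$ is the group of all permutations of $\mathbb N$, with the topology in which the subgroups $\overline S_\infty[\alpha]$ of permutations fixing $1,\dots,\alpha$ form a fundamental system of open neighborhoods of the unit. $G=S_\infty\times S_\infty\times S_\infty$, $K$ is the diagonal subgroup of $G$, $K[\alpha]\subset K$ is the subgroup of $(h,h,h)$ with $h$ fixing $1,\dots,\alpha$. The trisymmetric group $\mathbf G\subset\overline S_\infty\times\overline S_\infty\times\overline S_\infty$ consists of triples $(g_{1},g_{2},g_{3})$ with $g_{1}g_{2}^{-1},\,g_{2}g_{3}^{-1}\in S_\infty$; equivalently it is generated by $G$ and the diagonal subgroup $\mathbf K=\{(g,g,g):g\in\overline S_\infty\}$. Its topology is such that $\mathbf K\simeq\overline S_\infty$ has its standard topology and $\mathbf K$ is open (so $\mathbf G$ is the disjoint union of the open cosets $\mathbf G/\mathbf K$). Unitary representations of $\mathbf G$ are assumed continuous in the weak operator topology. $\mathbf K[\alpha]\subset\mathbf K$ is the subgroup corresponding to $\overline S_\infty[\alpha]$; the natural map $K[\alpha]\backslash G/K[\beta]\to\mathbf K[\alpha]\backslash\mathbf G/\mathbf K[\beta]$ is a bijection. The category $\mathcal K(G,K)$: objects are non-negative integers; morphisms $\beta\to\alpha$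 are double cosets $\mathfrak p\in K[\alpha]\backslash G/K[\beta]$. Product: let $\theta_j[\beta]\in K[\beta]$ be the diagonal element given by the permutation which exchanges $\beta+i$ and $\beta+j+i$ for $1\le i\le j$ and fixes all other points; for $p\in\mathfrak p\in K[\alpha]\backslash G/K[\beta]$, $q\in\mathfrak q\in K[\beta]\backslash G/K[\gamma]$ the sequence $K[\alpha]p\,\theta_j[\beta]\,qK[\gamma]$ is eventually constant, with limit independent of the choice of $p,q$, and $\mathfrak p\circ\mathfrak q$ is its limit. The involution $\mathfrak p\mapsto\mathfrak p^*$ is induced by $p\mapsto p^{-1}$. The unit automorphism $\mathrm{Id}_\alpha$ is the double coset of the unit. A $*$-representation $R$ of the category assigns to each $\alpha$ a Hilbert space $V[\alpha]$ and to each morphism $\mathfrak p:\beta\to\alpha$ a bounded operator $R(\mathfrak p):V[\beta]\to V[\alpha]$ such that $R(\mathfrak p\circ\mathfrak q)=R(\mathfrak p)R(\mathfrak q)$, $R(\mathfrak p^* )=R(\mathfrak p)^*$, $R(\mathrm{Id}_\alpha)=1_{V[\alpha]}$. Two such representations are equivalent if there are unitary operators between the corresponding spaces, for all $\alpha$, intertwining all the operators. For a unitary representation $\rho$ of $\mathbf G$ in $H$: $H[\alpha]$ is the subspace of $\mathbf K[\alpha]$-fixed vectors, $P[\alpha]$ is the orthogonal projection onto it, and $\widetilde\rho(\mathfrak p)=P[\alpha]\rho(p)|_{H[\beta]}:H[\beta]\to H[\alpha]$ for $p\in\mathfrak p$ (independent of the choice of $p$); this is a $*$-representation of $\mathcal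 K(G,K)$ in the spaces $H[\alpha]$. *)

(* Defs.v *)
From HB Require Import structures.
From mathcomp Require Import all_boot all_order all_algebra.
From mathcomp Require Import all_classical all_reals all_analysis.
From mathcomp Require Import complex zify ring lra.

Set Implicit Arguments.
Unset Strict Implicit.
Unset Printing Implicit Defensive.

Import Order.TTheory GRing.Theory Num.Theory.
Import numFieldNormedType.Exports.

Local Open Scope classical_set_scope.
Local Open Scope group_scope.

(* The points 1, 2, ... of the text are 0, 1, ... here, so that "fixing
   1, ..., alpha" reads "fixing every i < alpha". *)
Record permN := PermN {
  permN_fun :> nat -> nat;
  permN_inv : nat -> nat;
  permN_funK : cancel permN_fun permN_inv;
  permN_invK : cancel permN_inv permN_fun }.

Lemma permN_eq (g h : permN) : g =1 h -> g = h.
Proof.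
case: g h => [f f' fK f'K] [k k' kK k'K] /= /funext fk; subst k.
suff e : f' = k' by subst k'; congr PermN; exact: Prop_irrelevance.
by apply/funext => x; rewrite -[x in LHS]k'K fK.
Qed.

HB.instance Definition _ := gen_eqMixin permN.
HB.instance Definition _ := gen_choiceMixin permN.

Definition permN_one : permN := @PermN id id (fun=> erefl) (fun=> erefl).

(* Permutations act on the left: (g * h) x = g (h x). *)
Definition permN_mul (g h : permN) : permN :=
  PermN (can_comp (@permN_funK g) (@permN_funK h))
        (can_comp (@permN_invK h) (@permN_invK g)).

Definition permN_invg (g : permN) : permN :=
  PermN (@permN_invK g) (@permN_funK g).

Lemma permN_mulA : associative permN_mul.
Proof. by move=> a b c; exact: permN_eq. Qed.
Lemma permN_mul1 : left_id permN_one permN_mul.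
Proof. by move=> a; exact: permN_eq. Qed.
Lemma permN_1mul : right_id permN_one permN_mul.
Proof. by move=> a; exact: permN_eq. Qed.
Lemma permN_mulV : left_inverse permN_one permN_invg permN_mul.
Proof. by move=> a; apply: permN_eq => x /=; exact: permN_funK. Qed.
Lemma permN_Vmul : right_inverse permN_one permN_invg permN_mul.
Proof. by move=> a; apply: permN_eq => x /=; exact: permN_invK. Qed.

HB.instance Definition _ := isGroup.Build permN
  permN_mulA permN_mul1 permN_1mul permN_mulV permN_Vmul.

Lemma permM (g h : permN) x : (g * h) x = g (h x). Proof. by []. Qed.
Lemma perm1 x : (1 : permN) x = x. Proof. by []. Qed.
Lemma permVK (g : permN) : cancel g (g^-1)%g. Proof. exact: permN_funK. Qed.
Lemma permKV (g : permN) : cancel (g^-1)%g g. Proof. exact: permN_invK. Qed.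
Lemma permV_fix (g : permN) x : g x = x -> (g^-1)%g x = x.
Proof. by move=> gx; rewrite -{1}gx permVK. Qed.

Definition fixes (alpha : nat) (g : permN) : Prop :=
  forall i, (i < alpha)%N -> g i = i.

Lemma fixes1 alpha : fixes alpha 1. Proof. by []. Qed.
Lemma fixesM alpha g h : fixes alpha g -> fixes alpha h -> fixes alpha (g * h).
Proof. by move=> fg fh i ia; rewrite permM fh ?fg. Qed.
Lemma fixesV alpha g : fixes alpha g -> fixes alpha g^-1.
Proof. by move=> fg i ia; apply: permV_fix; exact: fg. Qed.

Definition permN_open : set_system permN :=
  [set U | forall g, U g ->
    exists alpha, forall k, fixes alpha k -> U (g * k)].

Lemma permN_openT : permN_open setT.
Proof. by move=> g _; exists 0%N. Qed.

Lemma permN_openI : setI_closed permN_open.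
Proof.
move=> U V oU oV g [/oU[a aU] /oV[b bV]]; exists (maxn a b) => k fk.
by split; [apply: aU|apply: bV] => i ?; apply: fk; rewrite leq_max; lia.
Qed.

Lemma permN_open_bigU (I : Type) (f : I -> set permN) :
  (forall i, permN_open (f i)) -> permN_open (\bigcup_i f i).
Proof.
move=> of_ g [i _ /(of_ i)[a aU]]; exists a => k fk; exists i => //.
exact: aU.
Qed.

HB.instance Definition _ := isOpenTopological.Build permN
  permN_openT permN_openI permN_open_bigU.

Definition finsupp : {pred permN} :=
  fun g => `[< finite_set [set x | g x <> x] >].

Lemma finsuppP (g : permN) :
  reflect (exists n, forall x, (n <= x)%N -> g x = x) (g \in finsupp).
Proof.
apply: (iffP (asboolP _)) => [/finite_seqP[X eX]|[n gn]].
  exists (\max_(x <- X) x).+1 => x xn; apply: contrapT => gx.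
  have : x \in X by move: gx; rewrite -[_ <> _]/([set x | g x <> x] x) eX.
  by move=> xX; have := @leq_bigmax_seq _ X predT (fun i : nat => i) x xX isT; rewrite leqNgt xn.
apply: (@sub_finite_set _ _ `I_n); last exact: finite_II.
by move=> x /= gx; case: (ltnP x n) => // /gn.
Qed.

Lemma finsupp_group : group_closed finsupp.
Proof.
split; first by apply/finsuppP; exists 0%N.
move=> g h /finsuppP[n gn] /finsuppP[m hm]; apply/finsuppP.
exists (maxn n m) => x; rewrite geq_max => /andP[nx mx].
by rewrite permM (permV_fix (hm _ mx)) gn.
Qed.

Record Sinf := MkSinf { Sinf_val :> permN; _ : Sinf_val \in finsupp }.
HB.instance Definition _ := [isSub for Sinf_val].
HB.instance Definition _ := [Choice of Sinf by <:].
HB.instance Definition _ := SubChoice_isSubGroup.Build permN finsupp Sinf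
  finsupp_group.

Definition G : Type := (Sinf * Sinf * Sinf)%type.
HB.instance Definition _ := Group.on G.

Definition Gdiag (h : Sinf) : G := (h, h, h).

Definition K (alpha : nat) : set G :=
  [set Gdiag h | h in [set h : Sinf | fixes alpha h]].

Definition tripermN : Type := (permN * permN * permN)%type.
HB.instance Definition _ := Group.on tripermN.

Definition in_trisym : {pred tripermN} := fun g =>
  (g.1.1 * g.1.2^-1 \in finsupp) && (g.1.2 * g.2^-1 \in finsupp).

Lemma finsuppM g h : g \in finsupp -> h \in finsupp -> g * h \in finsupp.
Proof. exact: (group_closedM finsupp_group). Qed.
Lemma finsuppV g : g \in finsupp -> g^-1 \in finsupp.
Proof. exact: (group_closedV finsupp_group). Qed.
Lemma finsuppJ (g h : permN) : g \in finsupp -> h * g * h^-1 \in finsupp.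
Proof.
move=> /asboolP fg; apply/asboolP.
apply: sub_finite_set (finite_image h fg) => x hgx.
exists ((h^-1)%g x); last exact: permKV.
by move=> e; apply: hgx; exact: etrans (congr1 h e) (permKV h x).
Qed.

Lemma trisym_group : group_closed in_trisym.
Proof.
have key a b c d : a * b^-1 \in finsupp -> c * d^-1 \in finsupp ->
    (a / c) * (b / d)^-1 \in finsupp.
  move=> ab cd; have -> : (a / c) * (b / d)^-1 =
      (a * (c^-1 * d) * a^-1) * (a * b^-1).
    by rewrite invgF !mulgA mulgVK.
  apply: finsuppM => //; apply: finsuppJ.
  have -> : c^-1 * d = c^-1 * (c * d^-1)^-1 * (c^-1)^-1.
    by rewrite invgF invgK !mulgA mulgVK.
  by apply: finsuppJ; exact: finsuppV.
split; first by apply/andP; split; rewrite /= mulgV; exact: finsupp_group.1.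
move=> [[a1 a2] a3] [[b1 b2] b3] /andP[/= ? ?] /andP[/= ? ?].
by apply/andP; split => /=; exact: key.
Qed.

Record trisym := MkTrisym { trisym_val :> tripermN; _ : trisym_val \in in_trisym }.
HB.instance Definition _ := [isSub for trisym_val].
HB.instance Definition _ := [Choice of trisym by <:].
HB.instance Definition _ := SubChoice_isSubGroup.Build tripermN in_trisym trisym
  trisym_group.

Fact tdiag_subproof (h : permN) : ((h, h, h) : tripermN) \in in_trisym.
Proof. by apply/andP; split; rewrite /= mulgV; exact: finsupp_group.1. Qed.
Definition tdiag (h : permN) : trisym := MkTrisym (tdiag_subproof h).

Definition tK (alpha : nat) : set trisym :=
  [set tdiag h | h in fixes alpha].

Fact trisym_of_G_subproof (g : G) :
  ((Sinf_val g.1.1, Sinf_val g.1.2, Sinf_val g.2) : tripermN) \in in_trisym.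
Proof.
by apply/andP; split; apply: finsuppM; rewrite ?finsuppV ?(valP (_ : Sinf)).
Qed.
Definition trisym_of_G (g : G) : trisym := MkTrisym (trisym_of_G_subproof g).

(* The diagonal subgroup is open and carries the topology of [permN], and the
   group is the topological disjoint union of its cosets. *)
Definition trisym_open : set_system trisym :=
  [set U | forall g, open [set k : permN | U (g * tdiag k)]].

Lemma trisym_openT : trisym_open setT.
Proof. by move=> g; exact: openT. Qed.
Lemma trisym_openI : setI_closed trisym_open.
Proof. by move=> U V oU oV g; exact: openI (oU g) (oV g). Qed.
Lemma trisym_open_bigU (I : Type) (f : I -> set trisym) :
  (forall i, trisym_open (f i)) -> trisym_open (\bigcup_i f i).
Proof. by move=> of_ g; exact: (bigcup_open (fun i _ => of_ i g)). Qed.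

HB.instance Definition _ := isOpenTopological.Build trisym
  trisym_openT trisym_openI trisym_open_bigU.

Lemma tdiagM h k : tdiag (h * k) = tdiag h * tdiag k.
Proof. exact: val_inj. Qed.
Lemma tdiag1 : tdiag 1 = 1. Proof. exact: val_inj. Qed.

Lemma trisym_nbhsP (g : trisym) (A : set trisym) :
  nbhs g A <-> exists alpha, forall k, tK alpha k -> A (g * k).
Proof.
split=> [|[a aA]].
  rewrite nbhsE => -[U [oU Ug] UA].
  have [|a aU] := oU g 1; first by rewrite /= tdiag1 mulg1.
  exists a => _ [k fk <-]; apply: UA; have := aU k fk.
  by rewrite /= mul1g.
rewrite nbhsE; exists [set g * k | k in tK a].
  split=> //; last by exists 1; [exists 1 => //; exact: tdiag1|exact: mulg1].
  move=> x; change (permN_open [set k | [set g * k0 | k0 in tK a] (x * tdiag k)]).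
  move=> k /= [_ [l fl <-] e]; exists a => l' fl'; exists (tdiag (l * l')).
    by exists (l * l') => //; exact: fixesM.
  by rewrite !tdiagM !mulgA e.
by move=> _ [k ak <-]; exact: aA.
Qed.

Lemma trisym_generated (g : trisym) : exists x h, g = trisym_of_G x * tdiag h.
Proof.
case: g => [[[a b] c] abc]; have /andP[/= ab bc] := abc.
have ac : a * c^-1 \in finsupp.
  by have := finsuppM ab bc; rewrite mulgA mulgVK.
exists (MkSinf ac, MkSinf bc, 1), c; apply: val_inj => /=.
by congr (_, _, _) => /=; rewrite ?mulgVK ?mul1g.
Qed.

Definition dcoset (alpha beta : nat) (p : G) : set G :=
  [set k * p * l | k in K alpha & l in K beta].

(* Morphisms beta -> alpha. *)
Record mor (beta alpha : nat) := Mor {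
  mor_set : set G;
  _ : exists p, mor_set = dcoset alpha beta p }.

Local Ltac if_lia := repeat match goal with
  | |- context [if ?c then _ else _] => lazymatch c with
      | context [if _ then _ else _] => fail
      | _ => let H := fresh in case: (boolP c) => H
      end end; lia.

Lemma K1 alpha : K alpha 1. Proof. by exists 1. Qed.
Lemma KM alpha a b : K alpha a -> K alpha b -> K alpha (a * b).
Proof.
by move=> [h fh <-] [k fk <-]; exists (h * k) => //; exact: fixesM.
Qed.
Lemma KV alpha a : K alpha a -> K alpha a^-1.
Proof. by move=> [h fh <-]; exists h^-1 => //; exact: fixesV. Qed.

Lemma dcoset_self alpha beta p : dcoset alpha beta p p.
Proof. by exists 1; [exact: K1|exists 1; [exact: K1|rewrite mul1g mulg1]]. Qed.

Lemma dcoset_mul alpha beta k p l : K alpha k -> K beta l ->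
  dcoset alpha beta (k * p * l) = dcoset alpha beta p.
Proof.
move=> Kk Kl; apply/seteqP; split=> _ [a Ka [b Kb <-]].
  exists (a * k); first exact: KM.
  by exists (l * b); [exact: KM|rewrite !mulgA].
exists (a * k^-1); first by apply: KM => //; exact: KV.
exists (l^-1 * b); first by apply: KM => //; exact: KV.
by rewrite !mulgA mulgVK mulgK.
Qed.

Lemma dcosetP alpha beta (P : mor beta alpha) p :
  mor_set P p -> mor_set P = dcoset alpha beta p.
Proof.
by case: P => S [q e] /=; rewrite {}e => -[a Ka [b Kb <-]]; rewrite dcoset_mul.
Qed.

Lemma mor_eq alpha beta (P Q : mor beta alpha) : mor_set P = mor_set Q -> P = Q.
Proof.
by case: P Q => [A HA] [B HB] /= e; subst B; congr Mor; exact: Prop_irrelevance.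
Qed.

Definition mor_of (beta alpha : nat) (p : G) : mor beta alpha :=
  Mor (ex_intro _ p erefl).

(* With points numbered from 0: exchanges beta + i and beta + j + i for
   0 <= i < j. *)
Definition theta_fun (j beta x : nat) : nat :=
  if (beta <= x < beta + j)%N then (x + j)%N
  else if (beta + j <= x < beta + j + j)%N then (x - j)%N
  else x.

Fact theta_funK j beta : involutive (theta_fun j beta).
Proof. by move=> x; rewrite /theta_fun; if_lia. Qed.

Definition theta_perm j beta : permN :=
  PermN (@theta_funK j beta) (@theta_funK j beta).

Fact theta_finsupp j beta : theta_perm j beta \in finsupp.
Proof.
by apply/finsuppP; exists (beta + j + j)%N => x /=; rewrite /theta_fun; if_lia.
Qed.

Definition theta (j beta : nat) : G := Gdiag (MkSinf (theta_finsupp j beta)).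

Section CompositionOfDoubleCosets.

Let below (N : nat) (g : permN) := forall x, (N <= x)%N -> g x = x.
Let belowG (N : nat) (g : G) := [/\ below N g.1.1, below N g.1.2 & below N g.2].

Let belowG_ex (g : G) : exists N, belowG N g.
Proof.
case: g => -[[a ha] [b hb]] [c hc].
have /finsuppP[n an] := ha; have /finsuppP[m bm] := hb.
have /finsuppP[k ck] := hc; exists (maxn n (maxn m k)).
by split=> x; rewrite !geq_max => /and3P[? ? ?] /=; auto.
Qed.

Let belowS N M g : (N <= M)%N -> belowG N g -> belowG M g.
Proof.
by move=> NM [? ? ?]; split => x Mx; auto using (leq_trans NM Mx).
Qed.

Let below_comm N (g h : permN) : below N g -> fixes N h -> g * h = h * g.
Proof.
move=> gN hN; apply: permN_eq => x; rewrite !permM; case: (ltnP x N) => xN.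
  rewrite hN//; case: (ltnP (g x) N) => [gxN|/gN gg]; first by rewrite hN.
  by rewrite (can_inj (permVK g) gg) hN.
rewrite (gN x)//; case: (ltnP (h x) N) => [/hN hh|/gN//].
by rewrite (can_inj (permVK h) hh) gN.
Qed.

Let belowG_comm N (g : G) (h : Sinf) :
  belowG N g -> fixes N h -> g * Gdiag h = Gdiag h * g.
Proof.
case: g => -[a b] c [/= aN bN cN] hN.
by congr (_, _, _); apply: val_inj; exact: (@below_comm N).
Qed.

Let fixesS N M h : (N <= M)%N -> fixes M h -> fixes N h.
Proof. by move=> NM hM x xN; apply: hM; exact: leq_trans xN NM. Qed.

Let shift_fun beta N j j' x : nat :=
  if (beta + j <= x < N + j)%N then (x + j' - j)%N
  else if (beta + j' <= x < N + j')%N then (x + j - j')%N else x.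

Let shift_stab alpha beta gamma p q N j j' :
  belowG N p -> belowG N q -> (alpha <= N)%N -> (beta <= N)%N ->
  (gamma <= N)%N -> (N <= j)%N -> (j + N <= j')%N ->
  dcoset alpha gamma (p * theta j beta * q) =
  dcoset alpha gamma (p * theta j' beta * q).
Proof.
move=> pN qN aN bN cN Nj jj'.
have sK : involutive (shift_fun beta N j j') by move=> x; rewrite /shift_fun; if_lia.
pose sp := PermN sK sK.
have sf : sp \in finsupp.
  by apply/finsuppP; exists (N + j')%N => x /=; rewrite /shift_fun; if_lia.
pose s := MkSinf sf.
pose t := MkSinf (theta_finsupp j beta); pose t' := MkSinf (theta_finsupp j' beta).
pose k : Sinf := t' * s * t.
have sN : fixes N s by move=> x xN /=; rewrite /shift_fun; if_lia.
have kN : fixes N k.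
  by move=> x xN /=; rewrite /theta_fun /shift_fun; if_lia.
have tt : t * t = 1.
  by apply: val_inj; apply: permN_eq => x /=; exact: theta_funK.
have ss : s * s = 1 by apply: val_inj; apply: permN_eq => x /=; exact: sK.
have e : theta j' beta = Gdiag k * theta j beta * Gdiag s.
  rewrite /theta -/t -/t'; suff -> : t' = k * t * s by [].
  by rewrite /k -!mulgA (mulgA t) tt mul1g ss mulg1.
have -> : p * theta j' beta * q = Gdiag k * (p * theta j beta * q) * Gdiag s.
  rewrite e !mulgA (belowG_comm pN kN) -!mulgA; do 3 congr (_ * _).
  by rewrite (belowG_comm qN sN).
rewrite (@dcoset_mul _ _ (Gdiag k) _ (Gdiag s))//.
  by exists k => //; exact: fixesS kN.
by exists s => //; exact: fixesS sN.
Qed.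

Let stab alpha beta gamma p q : exists N, forall j j', (N <= j)%N -> (N <= j')%N ->
  dcoset alpha gamma (p * theta j beta * q) =
  dcoset alpha gamma (p * theta j' beta * q).
Proof.
have [n pn] := belowG_ex p; have [m qm] := belowG_ex q.
pose N := (n + m + alpha + beta + gamma)%N.
have pN : belowG N p by apply: belowS pn; lia.
have qN : belowG N q by apply: belowS qm; lia.
exists N => j j' Nj Nj'.
rewrite (@shift_stab _ _ _ p q N j (j + j' + N))//; [|lia..].
by rewrite -(@shift_stab _ _ _ p q N j' (j + j' + N))//; lia.
Qed.

Let theta_conj N beta j (b : Sinf) : fixes beta b -> below j b -> (N <= j)%N ->
  (beta <= N)%N -> exists2 w : Sinf, fixes N w &
  Gdiag b * theta j beta = theta j beta * Gdiag w /\
  theta j beta * Gdiag b = Gdiag w * theta j beta.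
Proof.
move=> fb bj Nj bN; pose t := MkSinf (theta_finsupp j beta).
have tt : t * t = 1.
  by apply: val_inj; apply: permN_eq => x /=; exact: theta_funK.
exists (t * b * t); last first.
  have e1 : b * t = t * (t * b * t) by rewrite !mulgA tt mul1g.
  have e2 : t * b = t * b * t * t by rewrite -!mulgA tt mulg1.
  by split; [exact: (congr1 Gdiag e1)|exact: (congr1 Gdiag e2)].
move=> x xN /=; case: (ltnP x beta) => xb.
  have tx : theta_fun j beta x = x by rewrite /theta_fun; if_lia.
  by rewrite tx fb.
have tx : theta_fun j beta x = (x + j)%N by rewrite /theta_fun; if_lia.
by rewrite tx bj ?leq_addl// -tx theta_funK.
Qed.

Lemma dcoset_comp_subproof (alpha beta gamma : nat)
    (P : mor beta alpha) (Q : mor gamma beta) :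
  exists R : mor gamma alpha, forall p q, mor_set P p -> mor_set Q q ->
    \forall j \near \oo, dcoset alpha gamma (p * theta j beta * q) = mor_set R.
Proof.
case: P Q => [S [p eS]] [T [q eT]] /=; rewrite {}eS {}eT.
have [N Nst] := stab alpha beta gamma p q.
exists (mor_of gamma alpha (p * theta N beta * q)).
move=> _ _ [a Ka [b Kb <-]] [c Kc [d Kd <-]].
have [n pn] := belowG_ex p; have [m qm] := belowG_ex q.
case: Kb => {}b fb <-; case: Kc => {}c fc <-.
have [m' cqm] := belowG_ex (Gdiag c * q).
have /finsuppP[b' bb] := valP b; have /finsuppP[c' cc] := valP c.
pose M := (N + n + m + m' + alpha + beta + gamma)%N.
exists (M + b' + c')%N => // j /= jM.
have [|||w fw [bw _]] := @theta_conj M beta j b fb; [|lia|lia|].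
  by move=> x xj; apply: bb; lia.
have [|||v fv [_ cv]] := @theta_conj M beta j c fc; [|lia|lia|].
  by move=> x xj; apply: cc; lia.
have -> : a * p * Gdiag b * theta j beta * (Gdiag c * q * d) =
    a * (Gdiag v * (p * theta j beta * q) * Gdiag w) * d.
  have cqM : belowG M (Gdiag c * q) by apply: belowS cqm; lia.
  have pM : belowG M p by apply: belowS pn; lia.
  rewrite -!mulgA; congr (a * _); rewrite !mulgA; congr (_ * d).
  rewrite -(mulgA _ (Gdiag b)) bw !mulgA -(belowG_comm pM fv).
  by rewrite -!mulgA -(belowG_comm cqM fw) !mulgA -(mulgA p (theta j beta)) cv !mulgA.
rewrite (dcoset_mul _ Ka Kd) (@dcoset_mul _ _ (Gdiag v) _ (Gdiag w)).
- by apply: Nst => //; lia.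
- by exists v => //; apply: fixesS fv; lia.
- by exists w => //; apply: fixesS fw; lia.
Qed.

End CompositionOfDoubleCosets.

(* The limit of the eventually constant sequence
   K[alpha] p theta_j[beta] q K[gamma]: see mor_compP. *)
Definition mor_comp (alpha beta gamma : nat)
    (P : mor beta alpha) (Q : mor gamma beta) : mor gamma alpha :=
  sval (cid (dcoset_comp_subproof P Q)).

Lemma mor_compP alpha beta gamma (P : mor beta alpha) (Q : mor gamma beta) p q :
  mor_set P p -> mor_set Q q ->
  \forall j \near \oo, dcoset alpha gamma (p * theta j beta * q) =
    mor_set (mor_comp P Q).
Proof. exact: (svalP (cid (dcoset_comp_subproof P Q))). Qed.

Fact mor_star_subproof alpha beta (P : mor beta alpha) :
  exists p, [set g^-1 | g in mor_set P] = dcoset beta alpha p.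
Proof.
case: P => S [p e] /=; rewrite {}e; exists p^-1; apply/seteqP; split.
  move=> _ [_ [a Ka [b Kb <-]] <-]; exists b^-1; first exact: KV.
  by exists a^-1; [exact: KV|rewrite !invgM mulgA].
move=> _ [a Ka [b Kb <-]]; exists (b^-1 * p * a^-1); last first.
  by rewrite !invgM !invgK mulgA.
by exists b^-1; [exact: KV|exists a^-1 => //; exact: KV].
Qed.

Definition mor_star (alpha beta : nat) (P : mor beta alpha) : mor alpha beta :=
  Mor (mor_star_subproof P).

Definition mor_id (alpha : nat) : mor alpha alpha := mor_of alpha alpha 1.

Local Open Scope ring_scope.

(* The inner product is linear in the first argument and conjugate-linear in
   the second one. *)
HB.mixin Record isHilbert (R : realType) V of CompleteNormedModule R[i] V := {
  inner : {dot V for (@Num.conj R[i])};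
  sqr_normE : forall x : V, `|x| ^+ 2 = inner x x }.

#[short(type="hilbertType")]
HB.structure Definition Hilbert (R : realType) :=
  {V of isHilbert R V & CompleteNormedModule R[i] V}.

Section HilbertTheory.
Context {R : realType} {H : hilbertType R}.
Implicit Types x y z : H.

Lemma innerDl x y z : inner (x + y) z = inner x z + inner y z.
Proof. exact: linearDl. Qed.
Lemma innerDr x y z : inner x (y + z) = inner x y + inner x z.
Proof. exact: linearDr. Qed.
Lemma innerNl x y : inner (- x) y = - inner x y.
Proof. exact: linearNl. Qed.
Lemma innerNr x y : inner x (- y) = - inner x y.
Proof. exact: linearNr. Qed.
Lemma innerBl x y z : inner (x - y) z = inner x z - inner y z.
Proof. exact: linearBl. Qed.
Lemma innerBr x y z : inner x (y - z) = inner x y - inner x z.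
Proof. exact: linearBr. Qed.
Lemma inner0l x : inner 0 x = 0. Proof. exact: linear0l. Qed.
Lemma inner0r x : inner x 0 = 0. Proof. exact: linear0r. Qed.
Lemma innerZl a x y : inner (a *: x) y = a * inner x y.
Proof. exact: linearZl_LR. Qed.
Lemma innerZr a x y : inner x (a *: y) = a^* * inner x y.
Proof. exact: linearZr_LR. Qed.
Lemma innerC x y : inner x y = (inner y x)^*.
Proof. by rewrite hermC expr0 mul1r. Qed.
Lemma inner_eq0 x : (inner x x == 0) = (x == 0).
Proof. by rewrite -sqr_normE expf_eq0 /= normr_eq0. Qed.
Lemma inner_ge0 x : 0 <= inner x x.
Proof. by rewrite -sqr_normE exprn_ge0. Qed.
Lemma inner_inj x y : (forall z, inner x z = inner y z) -> x = y.
Proof.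
move=> xy; apply/eqP; rewrite -subr_eq0 -inner_eq0 innerBl.
by rewrite xy subrr.
Qed.

Lemma parallelogram x y :
  `|x + y| ^+ 2 + `|x - y| ^+ 2 = (`|x| ^+ 2 + `|y| ^+ 2) *+ 2.
Proof.
by rewrite !sqr_normE !innerDl !innerDr !innerNl !innerNr; ring.
Qed.

End HilbertTheory.

Record closedSubspace (R : realType) (H : hilbertType R) := ClosedSubspace {
  csub :> {pred H};
  csub_submod : submod_closed csub;
  csub_closed : closed [set x | x \in csub] }.

Section ClosedSubspaceHilbert.
Context {R : realType} {H : hilbertType R} (W : closedSubspace H).

Record cspace := CSpace { cval :> H; _ : cval \in csub W }.
HB.instance Definition _ := [isSub for cval].
HB.instance Definition _ := [Choice of cspace by <:].
HB.instance Definition _ := GRing.SubChoice_isSubLmodule.Build R[i] H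
  (csub W) cspace (csub_submod W).

Definition cnorm (x : cspace) : R[i] := `|cval x|.

Fact cnorm_triangle x y : cnorm (x + y) <= cnorm x + cnorm y.
Proof. exact: ler_normD. Qed.
Fact cnormZ (a : R[i]) x : cnorm (a *: x) = `|a| * cnorm x.
Proof. exact: normrZ. Qed.
Fact cnorm_eq0 x : cnorm x = 0 -> x = 0.
Proof. by move=> /normr0_eq0 x0; exact: val_inj. Qed.

HB.instance Definition _ := Lmodule_isNormed.Build R[i] cspace
  cnorm_triangle cnormZ cnorm_eq0.

Fact cspace_complete (F : set_system cspace) :
  ProperFilter F -> cauchy F -> cvg F.
Proof.
move=> FF Fc.
have /cauchy_cvg/cvg_ex[l Fl] : cauchy (cval @ F).
  apply/cauchy_ballP => e e0.
  move/cauchy_ballP : Fc => /(_ e e0)[[A B] /= [FA FB] AB].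
  exists (cval @` A, cval @` B) => /=.
    by split; [move: FA|move: FB]; apply: filterS => x ?; exists x.
  move=> _ [[x Ax <-] [y By <-]] /=.
  by have := AB (x, y) (conj Ax By); rewrite -!ball_normE.
have Wl : l \in csub W.
  apply: (closed_cvg (u_ := cval) _ (@csub_closed _ _ W) _ _ Fl).
  by apply: nearW => x; exact: valP.
apply/cvg_ex; exists (CSpace Wl); apply/cvgrPdist_lt => e e0.
by move/cvgrPdist_lt : Fl => /(_ e e0).
Qed.

HB.instance Definition _ := Uniform_isComplete.Build cspace cspace_complete.

Definition cinner (x y : cspace) : R[i] := inner (cval x) (cval y).

Fact cinner_bilinear : bilinear_for *%R (Num.conj \; *%R) cinner.
Proof.
split=> [y a x x'|x a y y']; rewrite /cinner.
  by rewrite -[cval (_ + _)]/(a *: cval x + cval x') innerDl innerZl.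
by rewrite -[cval (_ + _)]/(a *: cval y + cval y') innerDr innerZr.
Qed.
HB.instance Definition _ := bilinear_isBilinear.Build R[i] cspace cspace R[i]
  *%R (Num.conj \; *%R) cinner cinner_bilinear.
Fact cinner_herm x y : cinner x y = (-1) ^+ false * Num.conj (cinner y x).
Proof. by rewrite expr0 mul1r; exact: innerC. Qed.
HB.instance Definition _ := isHermitianSesquilinear.Build R[i] cspace false
  Num.conj cinner cinner_herm.
Fact cinner_gt0 x : x != 0 -> 0 < cinner x x.
Proof.
move=> x0; rewrite lt_neqAle eq_sym inner_ge0 andbT inner_eq0.
by apply: contra x0 => /eqP x0; apply/eqP; exact: val_inj.
Qed.
HB.instance Definition _ := isDotProduct.Build R[i] cspace cinner cinner_gt0.

Fact cinner_sqr x : `|x| ^+ 2 = cinner x x.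
Proof. exact: sqr_normE. Qed.

HB.instance Definition _ := isHilbert.Build R cspace cinner_sqr.
End ClosedSubspaceHilbert.

Section Projection.
Context {R : realType} {H : hilbertType R} (W : closedSubspace H).

Let hn (v : H) : R := complex.Re `|v|.

Let hnE v : `|v| = (hn v)%:C%C.
Proof.
have := normr_ge0 v; rewrite /hn; case: `|v| => a b.
by rewrite lecE /= => /andP[/eqP -> _].
Qed.

Let hn_ge0 v : 0 <= hn v.
Proof. by have := normr_ge0 v; rewrite hnE lecR. Qed.

Let hnD u v : hn (u + v) <= hn u + hn v.
Proof. by rewrite -lecR rmorphD /= -!hnE; exact: ler_normD. Qed.

Let hn_par u v : hn (u + v) ^+ 2 + hn (u - v) ^+ 2 =
  (hn u ^+ 2 + hn v ^+ 2) *+ 2.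
Proof.
apply: (@complexI R); rewrite rmorphMn !rmorphD !rmorphXn /= -!hnE.
exact: parallelogram.
Qed.

Let hnMn u n : hn (u *+ n) = hn u *+ n.
Proof. by apply: (@complexI R); rewrite rmorphMn /= -!hnE normrMn. Qed.

Lemma proj_ex (x : H) :
  exists y : cspace W, forall z : cspace W, inner (x - cval y) (cval z) = 0.
Proof.
pose q (w : cspace W) := hn (x - cval w).
pose D := inf (range q).
have hinf : has_inf (range q).
  split; first by exists (q 0); exists 0.
  by exists 0 => _ [w _ <-]; exact: hn_ge0.
have Dq w : D <= q w by apply: ge_inf; [exact: hinf.2|exists w].
have D0 : 0 <= D.
  by apply: lb_le_inf; [exact: hinf.1|move=> _ [w _ <-]; exact: hn_ge0].
have close e w1 w2 : 0 < e -> q w1 < D + e -> q w2 < D + e ->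
    hn (cval w1 - cval w2) ^+ 2 < 4 * e * (2 * D + e).
  move=> e0 q1 q2.
  have := hn_par (x - cval w1) (x - cval w2).
  have -> : x - cval w1 - (x - cval w2) = - (cval w1 - cval w2).
    by rewrite opprB addrC addrA subrK opprB.
  have -> : hn (- (cval w1 - cval w2)) = hn (cval w1 - cval w2).
    by rewrite /hn normrN.
  pose w := 2^-1 *: (w1 + w2) : cspace W.
  have -> : x - cval w1 + (x - cval w2) = (x - cval w) *+ 2.
    rewrite -[cval w]/(2^-1 *: (cval w1 + cval w2)) mulrnBl addrACA -opprD.
    by rewrite -[X in _ = _ - X]scaler_nat scalerA divff ?scale1r// pnatr_eq0.
  rewrite hnMn -/(q w) -/(q w1) -/(q w2) => E.
  have := Dq w; have := Dq w1; have := Dq w2 => d2 d1 dw.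
  have s1 : q w1 ^+ 2 < (D + e) ^+ 2 by rewrite ltr_pXn2r ?nnegrE//; lra.
  have s2 : q w2 ^+ 2 < (D + e) ^+ 2 by rewrite ltr_pXn2r ?nnegrE//; lra.
  have s0 : D ^+ 2 <= q w ^+ 2 by rewrite ler_pXn2r ?nnegrE//; lra.
  move: E; rewrite -[q w *+ 2]mulr_natl exprMn => E.
  have -> : hn (cval w1 - cval w2) ^+ 2 =
    (q w1 ^+ 2 + q w2 ^+ 2) *+ 2 - 2%:R ^+ 2 * q w ^+ 2 by rewrite -E; ring.
  nra.
pose F := filter_from [set e : R | 0 < e] (fun e => [set w | q w < D + e]).
have FF : ProperFilter F.
  apply: filter_from_proper.
    apply: filter_from_filter; first by exists 1 => /=.
    move=> a b a0 b0; exists (Num.min a b) => /=; first by rewrite lt_min a0.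
    by move=> w /=; rewrite addr_minr lt_min => /andP[].
  move=> e e0; have [_ [w _ <-] qw] := inf_adherent e0 hinf.
  by exists w.
have Fc : cauchy F.
  apply/cauchy_ballP => e e0.
  have [r r0 er] : exists2 r : R, 0 < r & e = r%:C%C.
    case: e e0 => a b; rewrite ltcE /= => /andP[/eqP -> a0].
    by exists a.
  pose d := Num.min 1 (r ^+ 2 / (4 * (2 * D + 1))).
  have d0 : 0 < d.
    by rewrite lt_min ltr01 divr_gt0 ?exprn_gt0// mulr_gt0//; lra.
  have Fd : F [set w | q w < D + d] by exists d.
  exists ([set w | q w < D + d], [set w | q w < D + d]) => //= -[w1 w2] /=.
  move=> [q1 q2]; rewrite -ball_normE /ball_/= -[`|_|]/(`|cval w1 - cval w2|).
  rewrite hnE er ltcR -(@ltr_pXn2r _ 2)// ?nnegrE//; [|exact: ltW].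
  apply: lt_le_trans (close _ _ _ d0 q1 q2) _.
  have d1 : d <= 1 by rewrite ge_min lexx.
  have : d <= r ^+ 2 / (4 * (2 * D + 1)) by rewrite ge_min lexx orbT.
  rewrite ler_pdivlMr; last by rewrite mulr_gt0//; lra.
  nra.
move: (Fc) => /cauchy_cvg/cvg_ex[y Fy].
have qy w : q y <= q w.
  suff : q y <= D by move=> /le_trans; apply.
  apply/ler_addgt0Pr => e e0.
  have e2 : 0 < e / 2 by rewrite divr_gt0.
  have e2C : 0 < (e / 2)%:C%C by rewrite ltcR.
  have Fe : F [set w | q w < D + e / 2] by exists (e / 2).
  have {}Fy := (@cvgrPdist_lt _ _ _ F FF id y).1 Fy _ e2C.
  have [v [/= qv vy]] := filter_ex (filterI Fe Fy).
  move: vy; rewrite -[`|_|]/(`|cval y - cval v|) distrC hnE ltcR => vy.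
  have := hnD (x - cval v) (cval v - cval y); rewrite addrA subrK.
  rewrite -/(q y) -/(q v); lra.
exists y => z; set u := x - cval y; set c := inner u _.
have [z0|z0] := eqVneq (inner (cval z) (cval z)) 0.
  by move/eqP: z0; rewrite inner_eq0 /c => /eqP ->; rewrite inner0r.
set s := inner (cval z) (cval z) in z0.
have s0 : 0 < s by rewrite lt_neqAle eq_sym z0 inner_ge0.
have := qy (y + (c / s) *: z).
rewrite -lecR /q -!hnE -(@ler_pXn2r _ 2)// ?nnegrE ?normr_ge0//.
rewrite -[cval (_ + _)]/(cval y + (c / s) *: cval z) opprD addrA.
rewrite -/u !sqr_normE; clearbody u.
rewrite !innerBl !innerBr !innerZl !innerZr -/s -/c.
have -> : inner (cval z) u = c^* by rewrite innerC.
have sr : s^* = s by apply: conj_Creal; exact: gtr0_real.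
rewrite rmorphM fmorphV /= sr.
have -> : inner u u - c^* / s * c - (c / s * c^* - c / s * (c^* / s * s)) =
   inner u u - c * c^* / s by field.
rewrite lerBrDl gerDr => cc.
have : c * c^* / s == 0.
  by rewrite eq_le cc mulr_ge0 ?mul_conjC_ge0 ?invr_ge0 ?ltW.
by rewrite mulf_eq0 invr_eq0 (negbTE z0) orbF mul_conjC_eq0 => /eqP.
Qed.

Definition proj (x : H) : cspace W := sval (cid (proj_ex x)).

Lemma projP x (z : cspace W) : inner (x - cval (proj x)) (cval z) = 0.
Proof. exact: (svalP (cid (proj_ex x)) z). Qed.

Lemma proj_unique x (y : cspace W) :
  (forall z : cspace W, inner (x - cval y) (cval z) = 0) -> proj x = y.
Proof.
move=> xy; apply: val_inj; apply/eqP; rewrite -subr_eq0 -inner_eq0 /=.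
have := projP x (proj x - y); have := xy (proj x - y).
rewrite -[cval (_ - _)]/(cval (proj x) - cval y) !innerBl => /eqP.
rewrite subr_eq0 => /eqP <- /eqP; rewrite subr_eq0 => /eqP e.
by rewrite -e subrr.
Qed.

Lemma inner_proj x (z : cspace W) :
  inner (cval (proj x)) (cval z) = inner x (cval z).
Proof.
by apply/esym/eqP; rewrite -subr_eq0 -innerBl projP.
Qed.

Fact proj_linear : linear proj.
Proof.
move=> a x y; apply: proj_unique => z.
rewrite -[cval (_ + _)]/(a *: cval (proj x) + cval (proj y)).
by rewrite innerBl !innerDl !innerZl !inner_proj subrr.
Qed.
HB.instance Definition _ := GRing.isLinear.Build R[i] H (cspace W) _ proj
  proj_linear.

Lemma norm_proj_le x : `|proj x| <= `|x|.
Proof.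
rewrite -(@ler_pXn2r _ 2)// ?nnegrE ?normr_ge0// !sqr_normE.
have := inner_ge0 (x - cval (proj x)).
rewrite innerBr projP subr0 innerBl subr_ge0.
have -> : inner (cval (proj x)) x = inner (proj x) (proj x).
  rewrite -[RHS]/(inner (cval (proj x)) (cval (proj x))).
  by rewrite innerC -inner_proj -innerC.
by [].
Qed.

Lemma continuous_proj : continuous proj.
Proof.
apply: bounded_linear_continuous; apply/linear_boundedP; near=> r => x.
apply: le_trans (norm_proj_le x) _; rewrite ler_peMl ?normr_ge0//.
Unshelve. all: by end_near. Qed.

End Projection.

Definition unitary (R : realType) (H H' : hilbertType R)
    (U : {linear H -> H'}) : Prop :=
  (forall x y, inner (U x) (U y) = inner x y) /\ (forall y, exists x, U x = y).

Definition bounded_operator (R : realType) (H H' : hilbertType R)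
    (A : {linear H -> H'}) : Prop :=
  exists M : R[i], forall x, `|A x| <= M * `|x|.

Lemma unitary_norm (R : realType) (H H' : hilbertType R)
  (U : {linear H -> H'}) x : unitary U -> `|U x| = `|x|.
Proof.
move=> [Ui _]; apply/eqP; rewrite -(@eqrXn2 _ 2)// ?normr_ge0//.
by rewrite !sqr_normE Ui.
Qed.

Record unitaryRep (R : realType) := UnitaryRep {
  uspace : hilbertType R;
  uact :> trisym -> {linear uspace -> uspace};
  uact_unitary : forall g, unitary (uact g);
  uact1 : forall x, uact 1%g x = x;
  uactM : forall g h x, uact (g * h)%g x = uact g (uact h x);
  uact_continuous : forall x y,
    continuous (fun g : trisym => inner (uact g x) y : (R[i])^o) }.

Definition unitaryRep_equiv (R : realType) (rho1 rho2 : unitaryRep R) : Prop :=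
  exists U : {linear uspace rho1 -> uspace rho2}, unitary U /\
    forall g x, U (rho1 g x) = rho2 g (U x).

(* Only the spaces and operators; the axioms of a *-representation are
   [star_representation]. *)
Record catRep (R : realType) := CatRep {
  rspace : nat -> hilbertType R;
  rop : forall beta alpha, mor beta alpha ->
    {linear rspace beta -> rspace alpha};
  rop_bounded : forall beta alpha (P : mor beta alpha),
    bounded_operator (rop P) }.

Definition star_representation (R : realType) (T : catRep R) : Prop :=
  [/\ forall alpha beta gamma (P : mor beta alpha) (Q : mor gamma beta) x,
        rop T (mor_comp P Q) x = rop T P (rop T Q x),
      forall alpha beta (P : mor beta alpha) x y,
        inner (rop T P x) y = inner x (rop T (mor_star P) y) &
      forall alpha x, rop T (mor_id alpha) x = x].

Definition catRep_equiv (R : realType) (T1 T2 : catRep R) : Prop :=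
  exists U : forall alpha, {linear rspace T1 alpha -> rspace T2 alpha},
    (forall alpha, unitary (U alpha)) /\
    forall alpha beta (P : mor beta alpha) x,
      U alpha (rop T1 P x) = rop T2 P (U beta x).

Section Tilde.
Context {R : realType} (rho : unitaryRep R).

Definition fixed_vectors (alpha : nat) : {pred uspace rho} :=
  fun x => `[< forall k, tK alpha k -> rho k x = x >].

Fact fixed_submod alpha : submod_closed (fixed_vectors alpha).
Proof.
split; first by apply/asboolP => k _; exact: linear0.
move=> a x y /asboolP fx /asboolP fy; apply/asboolP => k Kk.
by rewrite linearP fx ?fy.
Qed.

Fact fixed_closed alpha : closed [set x | x \in fixed_vectors alpha].
Proof.
have -> : [set x | x \in fixed_vectors alpha] =
    \bigcap_(k in tK alpha) [set x | rho k x - x = 0].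
  apply/seteqP; split=> x /=.
    by move=> /asboolP fx k /fx /= ->; rewrite subrr.
  by move=> fx; apply/asboolP => k /fx /= /subr0_eq.
apply: closed_bigI => k Kk.
have kc : continuous (rho k).
  apply: bounded_linear_continuous; apply/linear_boundedP; near=> r => x.
  by rewrite unitary_norm ?ler_peMl ?normr_ge0//; exact: uact_unitary.
have c : continuous (fun x => rho k x - x).
  by move=> x; apply: cvgB; [exact: kc|exact: cvg_id].
have /continuous_closedP/(_ [set 0]) : continuous (fun x => rho k x - x) by [].
by apply; apply: accessible_closed_set1; exact: hausdorff_accessible.
Unshelve. all: by end_near. Qed.

Definition fixed_space alpha : closedSubspace (uspace rho) :=
  ClosedSubspace (@fixed_submod alpha) (@fixed_closed alpha).

(* P[alpha] rho(g) restricted to the beta-fixed vectors. *)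
Definition compression (beta alpha : nat) (g : trisym) :
    {linear cspace (fixed_space beta) -> cspace (fixed_space alpha)} :=
  @proj _ _ (fixed_space alpha) \o rho g \o
    (\val : cspace (fixed_space beta) -> uspace rho).

Fact compression_bounded beta alpha g :
  bounded_operator (compression beta alpha g).
Proof.
exists 1 => x; rewrite mul1r.
apply: le_trans (norm_proj_le _ _) _.
by rewrite unitary_norm//; exact: uact_unitary.
Qed.

Lemma fixedP alpha (x : cspace (fixed_space alpha)) k :
  tK alpha k -> rho k (cval x) = cval x.
Proof.
have : cval x \in fixed_vectors alpha by exact: valP.
by move=> /asboolP fx; exact: fx.
Qed.

Lemma trisym_of_GM a b : trisym_of_G (a * b)%g = (trisym_of_G a * trisym_of_G b)%g.
Proof. exact: val_inj. Qed.

Lemma trisym_of_GK alpha a : K alpha a -> tK alpha (trisym_of_G a).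
Proof. by move=> [h fh <-]; exists h => //; exact: val_inj. Qed.

Lemma compression_dcoset beta alpha (P : mor beta alpha) p q :
  mor_set P p -> mor_set P q ->
  compression beta alpha (trisym_of_G p) =1 compression beta alpha (trisym_of_G q).
Proof.
move=> Pp; rewrite (dcosetP Pp) => -[a Ka [b Kb <-]] x.
apply: proj_unique => z; rewrite innerBl inner_proj !trisym_of_GM !uactM.
rewrite [rho (trisym_of_G b) _](fixedP x (trisym_of_GK Kb)).
rewrite -[in X in _ - X](fixedP z (trisym_of_GK Ka)).
by rewrite (uact_unitary rho (trisym_of_G a)).1 subrr.
Qed.

Fact mor_ex beta alpha (P : mor beta alpha) : exists p, mor_set P p.
Proof.
by case: P => S [p e]; exists p; rewrite /= e; exact: dcoset_self.
Qed.

Definition mor_repr beta alpha (P : mor beta alpha) : G :=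
  sval (cid (mor_ex P)).

(* By [tildeE] the choice of the representative is immaterial. *)
Definition tilde : catRep R :=
  @CatRep R (fun alpha => cspace (fixed_space alpha))
    (fun beta alpha P => compression beta alpha (trisym_of_G (mor_repr P)))
    (fun beta alpha P => compression_bounded beta alpha _).

Lemma tildeE beta alpha (P : mor beta alpha) p (x : rspace tilde beta) :
  mor_set P p ->
  rop tilde P x = proj (fixed_space alpha) (rho (trisym_of_G p) (cval x)).
Proof.
move=> Pp; exact: (compression_dcoset (svalP (cid (mor_ex P))) Pp).
Qed.

End Tilde.

(* Main.v *)
Require Import Defs.
From HB Require Import structures.
From mathcomp Require Import all_boot all_order all_algebra.
From mathcomp Require Import all_classical all_reals all_analysis.
From mathcomp Require Import complex zify ring lra.

(** Existence. Write V_n for the Hilbert space that the representation T of the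
    category attaches to n. The double cosets of the unit form a system of
    morphisms [1]_(m,n) from n to m with [1]_(m,n)* = [1]_(n,m), and
    [1]_(l,m) [1]_(m,n) = [1]_(l,n) as soon as m >= l or m >= n. Hence for
    m <= n the operator T([1]_(n,m)) is an isometric embedding of V_m in V_n and
    T([1]_(m,n)) is the orthogonal projection back. Let H be the Hilbert space
    completion of the union of the V_n. It is realised as the space of bounded
    threads (v_n) with T([1]_(m,n)) v_n = v_m for m <= n, the thread of v being
    its sequence of projections; the norm and the inner product are limits of
    those of the components ([tlim]).

    An element g of the trisymmetric group conjugates tK n into tK m for n large
    ([conj_sub_ex]), and some x in G lies in g (tK n) ([approx_ex]); then K m x
    absorbs x K n, and g acts by (g v)_m = T(K m x K n) v_n. The inclusion
    x K n inside K m x has three effects: the value does not depend on n and x,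
    products of such double cosets are products of representatives, because
    theta_j[n] can be moved to the left of x ([mor_comp_conj]), and
    T(K m x K n) is a contraction, being the adjoint of an isometry. So H carries
    a unitary representation of the trisymmetric group, continuous because
    tK m fixes V_m pointwise and the V_m span a dense subspace.

    It remains to see that the vectors fixed by tK m are exactly V_m
    ([lim_act_fixed]). The product [1]_(l,m) [1]_(m,n) is the double coset of
    theta_j[m] for j large, so the projection of V_n on V_m is, in matrix
    coefficients, the action of one element theta_j[m] of K m. A fixed vector
    does not feel this element; approximating it by vectors of V_n shows that it
    lies in V_m. The compression of g in G to the V_n is T of its double coset
    by construction.

    Uniqueness. For a continuous unitary representation rho, the union of the
    spaces of tK m-fixed vectors is dense ([fixed_total]): if v <> 0, then by
    continuity Re <rho k v, v> >= |v|^2 / 2 for all k in some tK m, and the vector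
    of least norm in the closed convex set of all w with
    Re <rho k w, v> >= |v|^2 / 2 for k in tK m is fixed by tK m, while it is not
    orthogonal to v. Hence v is determined by its projections P_m v, and bounded
    coherent families of fixed vectors are the families of projections of vectors
    ([fixed_thread_cvg]). As P_m rho(g) v = P_m rho(x) P_n v for n large and
    x in G close to g ([proj_uact]), the action of g is read off from the
    compressions too. So two representations with the same compressions are
    identified by matching vectors whose projections correspond. *)

Set Implicit Arguments.
Unset Strict Implicit.
Unset Printing Implicit Defensive.

Import Order.TTheory GRing.Theory Num.Theory.
Import numFieldNormedType.Exports.

Local Open Scope classical_set_scope.

(** * Permutations, the trisymmetric group and its double cosets *)

Section Groups.
Local Open Scope group_scope.

Definition swap_fun (a b x : nat) : nat :=
  if x == a then b else if x == b then a else x.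

Fact swap_funK a b : involutive (swap_fun a b).
Proof.
move=> x; rewrite /swap_fun; have [->|xa] := eqVneq x a.
  by have [->|] := eqVneq b a; rewrite ?eqxx.
have [->|xb] := eqVneq x b; first by rewrite eqxx.
by rewrite (negbTE xa) (negbTE xb).
Qed.

Definition swap (a b : nat) : permN := PermN (@swap_funK a b) (@swap_funK a b).

Lemma swap_finsupp a b : swap a b \in finsupp.
Proof.
apply/finsuppP; exists (maxn a b).+1 => x /=.
by rewrite gtn_max /swap_fun => /andP[ax bx]; rewrite !gtn_eqF.
Qed.

(** Density of the finitary permutations: to prescribe one more value h n,
    compose with the transposition of h' n and h n, which moves no earlier
    value. *)
Lemma finsupp_extend (h : permN) n :
  exists h' : Sinf, forall i, (i < n)%N -> h' i = h i.
Proof.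
elim: n => [|n [h' hh']]; first by exists 1.
exists (MkSinf (swap_finsupp (h' n) (h n)) * h') => i.
rewrite ltnS leq_eqVlt => /orP[/eqP -> | ltin].
  by rewrite /= /swap_fun eqxx.
rewrite /= /swap_fun (hh' _ ltin).
have ne : (h i == h n) = false by rewrite (can_eq (permVK h)) ltn_eqF.
by rewrite ne -(hh' _ ltin) (can_eq (permVK h')) ltn_eqF.
Qed.

Lemma fixes_leq m n (h : permN) : (m <= n)%N -> fixes n h -> fixes m h.
Proof. by move=> mn hn x xm; apply: hn; exact: leq_trans xm mn. Qed.

Lemma tK1 n : tK n 1.
Proof. by exists 1; [exact: fixes1|exact: tdiag1]. Qed.

Lemma tKM n a b : tK n a -> tK n b -> tK n (a * b).
Proof.
by move=> [h fh <-] [k fk <-]; exists (h * k); [exact: fixesM|exact: tdiagM].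
Qed.

Lemma tdiagV h : tdiag h^-1 = (tdiag h)^-1.
Proof. by apply/esym/mulg1_eq; rewrite -tdiagM mulgV tdiag1. Qed.

Lemma tKV n a : tK n a -> tK n a^-1.
Proof. by move=> [h fh <-]; exists h^-1; [exact: fixesV|exact: tdiagV]. Qed.

Lemma tK_leq m n a : (m <= n)%N -> tK n a -> tK m a.
Proof. by move=> mn [h fh <-]; exists h => //; exact: fixes_leq fh. Qed.

Lemma K_leq m n a : (m <= n)%N -> K n a -> K m a.
Proof. by move=> mn [h fh <-]; exists h => //; exact: fixes_leq fh. Qed.

Lemma K_theta m n j : (m <= n)%N -> K m (theta j n).
Proof.
move=> mn; exists (MkSinf (theta_finsupp j n)) => // x xm /=.
by rewrite /theta_fun; case: ifP => [|_]; [lia|case: ifP => //; lia].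
Qed.

Lemma trisym_of_G1 : trisym_of_G 1 = 1.
Proof. exact: val_inj. Qed.

Lemma trisym_of_GV a : trisym_of_G a^-1 = (trisym_of_G a)^-1.
Proof. by apply/esym/mulg1_eq; rewrite -trisym_of_GM mulgV trisym_of_G1. Qed.

(** tK n meets G exactly in K n; this direction gives uniqueness of approximants
    up to K n. *)
Lemma K_trisym_of_G n a : tK n (trisym_of_G a) -> K n a.
Proof.
case: a => [[a b] c] [h fh /(congr1 val)[ea eb ec]].
exists a; first by rewrite /= -ea.
by congr (_, _, _); apply: val_inj => /=; rewrite -?ea -?eb -?ec.
Qed.

(** Continuity of conjugation by g at the unit. In a unitary representation it
    implies that g^-1 maps the vectors fixed by tK m to vectors fixed by tK n.
    *)
Definition conj_sub (g : trisym) (m n : nat) : Prop :=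
  forall k, tK n k -> tK m (g * k * g^-1).

Lemma finsupp_comm N (g h : permN) : (forall x, (N <= x)%N -> g x = x) ->
  fixes N h -> g * h = h * g.
Proof.
move=> gN hN; apply: permN_eq => x; rewrite !permM; case: (ltnP x N) => xN.
  rewrite hN//; case: (ltnP (g x) N) => [gxN|/gN gg]; first by rewrite hN.
  by rewrite (can_inj (permVK g) gg) hN.
rewrite (gN x)//; case: (ltnP (h x) N) => [/hN hh|/gN//].
by rewrite (can_inj (permVK h) hh) gN.
Qed.

(** Write g = x h with x in G and h diagonal. For n large h K[n] h^-1 fixes a
    long initial segment, so it commutes with x, and conjugation by x does
    nothing. *)
Lemma conj_sub_ex (g : trisym) m : exists n, conj_sub g m n.
Proof.
have [x [h ->]] := trisym_generated g.
case: x => [[a b] c].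
have /finsuppP[na aN] := valP a; have /finsuppP[nb bN] := valP b.
have /finsuppP[nc cN] := valP c.
pose N := (na + nb + nc + m)%N.
exists (\max_(i < N) (h^-1 i)).+1 => _ [k fk <-].
exists (h * k * h^-1) => [i im|].
  rewrite !permM [k _]fk ?permKV // ltnS.
  have iN : (i < N)%N by rewrite /N; lia.
  exact: (@leq_bigmax _ (fun i : 'I_N => h^-1 i) (Ordinal iN)).
have fN : fixes N (h * k * h^-1).
  move=> i iN; rewrite !permM [k _]fk ?permKV // ltnS.
  exact: (@leq_bigmax _ (fun i : 'I_N => h^-1 i) (Ordinal iN)).
have comm (s : permN) n : (forall x, (n <= x)%N -> s x = x) -> (n <= N)%N ->
    s * h * k * (s * h)^-1 = h * k * h^-1.
  move=> sn nN.
  have sN x : (N <= x)%N -> s x = x by move=> Nx; apply: sn; exact: leq_trans Nx.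
  rewrite invgM -!mulgA (mulgA k) (mulgA h) (mulgA h) (mulgA s).
  by rewrite (finsupp_comm sN fN) mulgK.
by apply: val_inj; congr (_, _, _); rewrite /=;
  symmetry; [apply: (comm a _ aN)|apply: (comm b _ bN)|apply: (comm c _ cN)];
  rewrite /N; lia.
Qed.

Lemma conj_sub_leq g m n m' n' : (m' <= m)%N -> (n <= n')%N ->
  conj_sub g m n -> conj_sub g m' n'.
Proof.
by move=> mm nn gmn k kn; apply: tK_leq mm _; apply: gmn; exact: tK_leq kn.
Qed.

Lemma conj_subM g h l m n : conj_sub g l m -> conj_sub h m n ->
  conj_sub (g * h) l n.
Proof.
move=> gl hm k kn; have := gl _ (hm _ kn).
by rewrite invgM !mulgA.
Qed.

(** In a unitary representation, such an x acts like g on the vectors fixed by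
    tK n. *)
Definition approximates (g : trisym) (n : nat) (x : G) : Prop :=
  tK n (g^-1 * trisym_of_G x).

Lemma approx_ex g n : exists x, approximates g n x.
Proof.
have [x [h ->]] := trisym_generated g.
have [h' hh'] := finsupp_extend h n.
exists (x * Gdiag h'); exists (h^-1 * h') => [i ni|].
  by rewrite permM hh' // permVK.
have -> : trisym_of_G (x * Gdiag h') = trisym_of_G x * tdiag h'.
  by rewrite trisym_of_GM; congr (_ * _); exact: val_inj.
by rewrite tdiagM tdiagV invgM -!mulgA mulKg.
Qed.

Lemma approx_leq g m n x : (m <= n)%N -> approximates g n x -> approximates g m x.
Proof. by move=> mn; exact: tK_leq. Qed.

Lemma approx_of_G n x : approximates (trisym_of_G x) n x.
Proof. by rewrite /approximates mulVg; exact: tK1. Qed.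

(** x y = (g h) (h^-1 k h) l with k in tK m and l in tK n, so x has to be
    precise enough for h^-1 to conjugate its error k into tK n. *)
Lemma approxM g h m n x y : approximates g m x -> conj_sub h^-1 n m ->
  approximates h n y -> approximates (g * h) n (x * y).
Proof.
move=> gx hc hy; have := tKM (hc _ gx) hy.
by rewrite /approximates trisym_of_GM invgM invgK !mulgA mulgK.
Qed.

Lemma conj_sub_approx g m n x : conj_sub g m n -> approximates g n x ->
  forall k, K n k -> K m (x * k * x^-1).
Proof.
move=> gmn gx k kn; apply: K_trisym_of_G.
rewrite !trisym_of_GM trisym_of_GV.
have := gmn _ (tKM (tKM gx (trisym_of_GK kn)) (tKV gx)).
by rewrite invgM invgK !mulgA mulgV mul1g mulgK.
Qed.

Lemma mor_self (n m : nat) p : mor_set (mor_of n m p) p.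
Proof. exact: dcoset_self. Qed.

(** The limit that defines the product is eventually constant, so it is enough
    to find z in each double coset of the sequence. *)
Lemma mor_compE l m n x y z :
  (forall j, dcoset l n z (x * theta j m * y)) ->
  mor_comp (mor_of m l x) (mor_of n m y) = mor_of n l z.
Proof.
move=> zxy; apply: mor_eq => /=.
have [j jE] := filter_ex (mor_compP (mor_self m l x) (mor_self n m y)).
rewrite -jE; apply/esym.
exact: (@dcosetP _ _ (mor_of n l z) _ (zxy j)).
Qed.

(** When x K[m] x^-1 is in K[l], the factor theta_j[m] moves to the left of x
    and is absorbed: the product is the product of representatives. *)
Lemma mor_comp_conj l m n x y : (forall k, K m k -> K l (x * k * x^-1)) ->
  mor_comp (mor_of m l x) (mor_of n m y) = mor_of n l (x * y).
Proof.
move=> xml; apply: mor_compE => j.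
exists (x * theta j m * x^-1); first by apply: xml; exact: K_theta.
by exists 1; [exact: K1|rewrite mulg1 !mulgA mulgVK].
Qed.

Lemma mor_comp_id l m n x : (m <= n)%N ->
  mor_comp (mor_of n l x) (mor_of m n 1) = mor_of m l x.
Proof.
move=> mn; apply: mor_compE => j; exists 1; first exact: K1.
by exists (theta j n); [exact: K_theta|rewrite mul1g mulg1].
Qed.

(** theta_j[m] is in K[m], which is inside K[l] or K[n]. *)
Lemma mor_comp_embed l m n : (l <= m)%N || (n <= m)%N ->
  mor_comp (mor_of m l 1) (mor_of n m 1) = mor_of n l 1.
Proof.
case/orP => [lm|nm]; last exact: mor_comp_id.
by rewrite mor_comp_conj ?mulg1 // => k /(K_leq lm); rewrite mul1g invg1 mulg1.
Qed.

(** Without a condition on m the product of two unit double cosets keeps a trace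
    of theta_j[m]: the projection of level n on level m, seen at level l, is a
    matrix coefficient of an element of K[m]. *)
Lemma mor_comp_theta l m n : exists j,
  mor_comp (mor_of m l 1) (mor_of n m 1) = mor_of n l (theta j m).
Proof.
have [j jE] := filter_ex (mor_compP (mor_self m l 1) (mor_self n m 1)).
by exists j; apply: mor_eq; rewrite -jE mul1g mulg1.
Qed.

Lemma mor_starE m n x : mor_star (mor_of m n x) = mor_of n m x^-1.
Proof.
apply: mor_eq; apply: (@dcosetP _ _ (mor_star (mor_of m n x))).
by exists x => //; exact: dcoset_self.
Qed.

Lemma approximates_K g n x y :
  approximates g n x -> approximates g n y -> K n (x^-1 * y).
Proof.
move=> gx gy; apply: K_trisym_of_G; have := tKM (tKV gx) gy.
by rewrite invgM invgK mulgA mulgK trisym_of_GM trisym_of_GV.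
Qed.

(** y differs from x by a right factor in K[n], which conjugation by x turns
    into a left factor in K[m]; so the coset does not depend on the approximant,
    however large l is. *)
Lemma mor_of_approx g l m n x y : conj_sub g m n ->
  approximates g n x -> approximates g n y -> mor_of l m x = mor_of l m y.
Proof.
move=> gmn gx gy; apply: mor_eq => /=.
have kxy := approximates_K gy gx.
rewrite -(dcoset_mul y (conj_sub_approx gmn gy kxy) (K1 l)).
by rewrite mulg1 mulVKg mulgVK.
Qed.

Lemma mor_of_approx_right g m n x y : approximates g m x -> approximates g m y ->
  mor_of m n x = mor_of m n y.
Proof.
move=> gx gy; apply: mor_eq => /=.
have kxy := approximates_K gy gx.
by rewrite -(dcoset_mul y (K1 n) kxy) mul1g mulVKg.
Qed.

End Groups.

Local Open Scope ring_scope.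

(** * Real-valued norms in complex Hilbert spaces *)

Lemma ge0_complexE (R : realType) (z : R[i]) : 0 <= z -> z = (complex.Re z)%:C%C.
Proof. by case: z => a b; rewrite lecE /= => /andP[/eqP -> _]. Qed.

Lemma gt0_complexE (R : realType) (z : R[i]) :
  0 < z -> exists2 r : R, 0 < r & z = r%:C%C.
Proof. by case: z => a b; rewrite ltcE /= => /andP[/eqP -> a0]; exists a. Qed.

Section RealNorm.
Context {R : realType} {H : hilbertType R}.
Implicit Types u v : H.

(** The norm of a normed space over R[i] takes values in R[i]; real analysis is
    done with its real part, which determines it. *)
Definition rnorm v : R := complex.Re `|v|.

Lemma rnormE v : `|v| = (rnorm v)%:C%C.
Proof. exact/ge0_complexE/normr_ge0. Qed.

Lemma rnorm_ge0 v : 0 <= rnorm v.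
Proof. by have := normr_ge0 v; rewrite rnormE lecR. Qed.

Lemma rnormD u v : rnorm (u + v) <= rnorm u + rnorm v.
Proof. by rewrite -lecR rmorphD /= -!rnormE; exact: ler_normD. Qed.

Lemma rnormN v : rnorm (- v) = rnorm v.
Proof. by rewrite /rnorm normrN. Qed.

Lemma rnormBC u v : rnorm (u - v) = rnorm (v - u).
Proof. by rewrite /rnorm distrC. Qed.

Lemma rnorm0 : rnorm 0 = 0.
Proof. by rewrite /rnorm normr0. Qed.

Lemma rnorm_eq0 v : rnorm v = 0 -> v = 0.
Proof. by move=> v0; apply/normr0_eq0; rewrite rnormE v0. Qed.

Lemma rnormZ (a : R[i]) v : rnorm (a *: v) = complex.Re `|a| * rnorm v.
Proof.
by rewrite /rnorm normrZ rnormE; case: `|a| => x y /=; rewrite mulr0 subr0.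
Qed.

Lemma rnorm_sqr v : inner v v = (rnorm v ^+ 2)%:C%C.
Proof. by rewrite -sqr_normE rnormE rmorphXn. Qed.

Lemma rnorm_sqrE v : rnorm v ^+ 2 = complex.Re (inner v v).
Proof. by rewrite rnorm_sqr. Qed.

Lemma rnorm_par u v : rnorm (u + v) ^+ 2 + rnorm (u - v) ^+ 2 =
  (rnorm u ^+ 2 + rnorm v ^+ 2) *+ 2.
Proof.
apply: (@complexI R); rewrite rmorphMn !rmorphD !rmorphXn /= -!rnormE.
exact: parallelogram.
Qed.

Lemma Re_innerC u v : complex.Re (inner u v) = complex.Re (inner v u).
Proof. by rewrite innerC; case: (inner v u). Qed.

Lemma rnormD_sqr u v :
  rnorm (u + v) ^+ 2 = rnorm u ^+ 2 + rnorm v ^+ 2 + complex.Re (inner u v) *+ 2.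
Proof.
rewrite !rnorm_sqrE innerDl !innerDr !raddfD /= (Re_innerC v u).
ring.
Qed.

Lemma rnormB_sqr u v :
  rnorm (u - v) ^+ 2 = rnorm u ^+ 2 + rnorm v ^+ 2 - complex.Re (inner u v) *+ 2.
Proof. by rewrite rnormD_sqr rnormN innerNr raddfN /= mulNrn. Qed.

Lemma Im_inner u v : complex.Im (inner u v) = complex.Re (inner u ('i%C *: v)).
Proof.
rewrite innerZr; case: (inner u v) => a b /=.
by rewrite !mul0r !mulN1r opprK add0r.
Qed.

Lemma rnormZr (a : R) v : 0 <= a -> rnorm (a%:C%C *: v) = a * rnorm v.
Proof. by move=> a0; rewrite rnormZ ger0_norm ?lecR. Qed.

Lemma ReZ (a : R) (z : R[i]) : complex.Re (a%:C%C * z) = a * complex.Re z.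
Proof. by case: z => x y /=; rewrite mul0r subr0. Qed.

Lemma Re_innerZ (a : R) u v :
  complex.Re (inner (a%:C%C *: u) v) = a * complex.Re (inner u v).
Proof. by rewrite innerZl ReZ. Qed.

(** Expand the square of the norm of |v| u - |u| v. *)
Lemma Re_inner_le u v : complex.Re (inner u v) <= rnorm u * rnorm v.
Proof.
have [u0|u0] := eqVneq (rnorm u) 0.
  by rewrite u0 (rnorm_eq0 u0) inner0l mul0r.
have [v0|v0] := eqVneq (rnorm v) 0.
  by rewrite v0 (rnorm_eq0 v0) inner0r mulr0.
have {}u0 : 0 < rnorm u by rewrite lt_neqAle eq_sym u0 rnorm_ge0.
have {}v0 : 0 < rnorm v by rewrite lt_neqAle eq_sym v0 rnorm_ge0.
have := sqr_ge0 (rnorm ((rnorm v)%:C%C *: u - (rnorm u)%:C%C *: v)).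
rewrite rnormB_sqr !rnormZr ?rnorm_ge0 // Re_innerZ.
rewrite Re_innerC Re_innerZ Re_innerC => uv.
rewrite -(ler_pM2l (mulr_gt0 u0 v0)); lra.
Qed.

Lemma inner_le u v : `|inner u v| <= (rnorm u * rnorm v)%:C%C.
Proof.
set z := inner u v; pose r := complex.Re `|z|.
have zr : `|z| = r%:C%C by exact/ge0_complexE/normr_ge0.
have r0 : 0 <= r by rewrite -lecR -zr; exact: normr_ge0.
rewrite zr lecR.
have := Re_inner_le (z^* *: u) v; rewrite innerZl -/z mulrC -normCK zr.
rewrite -rmorphXn /= rnormZ norm_conjC -/r -mulrA expr2 => rr.
have [->|rn0] := eqVneq r 0; first by rewrite mulr_ge0 ?rnorm_ge0.
by rewrite -(@ler_pM2l _ r) // lt_neqAle eq_sym rn0.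
Qed.

End RealNorm.

(** Polarization. *)
Lemma isometry_inner (R : realType) (H H' : hilbertType R)
    (U : {linear H -> H'}) :
  (forall x, rnorm (U x) = rnorm x) ->
  forall x y, inner (U x) (U y) = inner x y.
Proof.
move=> Un.
have Re_eq x y : complex.Re (inner (U x) (U y)) = complex.Re (inner x y).
  have := rnormD_sqr (U x) (U y); rewrite -linearD !Un rnormD_sqr.
  by move=> e; lra.
move=> x y; apply/eqP; rewrite eq_complex Re_eq eqxx /=.
by rewrite !Im_inner -linearZ /= Re_eq.
Qed.

(** * Limits of towers of Hilbert spaces *)

Section ComplexLimit.
Context {R : realType}.
Implicit Types (u v : nat -> R[i]) (a b : R[i]).

(** Convergence in R[i] is taken componentwise, so that the completeness of R
    applies directly. *)
Definition clim u a : Prop :=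
  (fun n => complex.Re (u n)) @ \oo --> complex.Re a /\
  (fun n => complex.Im (u n)) @ \oo --> complex.Im a.

Lemma clim_unique u a b : clim u a -> clim u b -> a = b.
Proof.
move=> [ra ia] [rb ib]; apply/eqP; rewrite eq_complex.
by rewrite (cvg_unique _ ra rb) // (cvg_unique _ ia ib) // !eqxx.
Qed.

Lemma climD u v a b : clim u a -> clim v b -> clim (fun n => u n + v n) (a + b).
Proof.
move=> [ra ia] [rb ib]; split; rewrite raddfD.
  by under eq_fun do rewrite raddfD; exact: cvgD.
by under eq_fun do rewrite raddfD; exact: cvgD.
Qed.

Lemma climZ c u a : clim u a -> clim (fun n => c * u n) (c * a).
Proof.
case: c => x y [ra ia].
have ReM z : complex.Re ((x +i* y)%C * z) = x * complex.Re z - y * complex.Im z.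
  by case: z.
have ImM z : complex.Im ((x +i* y)%C * z) = x * complex.Im z + y * complex.Re z.
  by case: z.
split.
  rewrite ReM; under eq_fun do rewrite ReM.
  by apply: cvgB; apply: cvgMr.
rewrite ImM; under eq_fun do rewrite ImM.
by apply: cvgD; apply: cvgMr.
Qed.

Lemma clim_conj u a : clim u a -> clim (fun n => (u n)^*) (a^*).
Proof.
have ReC (z : R[i]) : complex.Re z^* = complex.Re z by case: z.
have ImC (z : R[i]) : complex.Im z^* = - complex.Im z by case: z.
move=> [ra ia]; split.
  by rewrite ReC; under eq_fun do rewrite ReC.
by rewrite ImC; under eq_fun do rewrite ImC; exact: cvgN.
Qed.

Lemma eq_clim u v a : u =1 v -> clim u a -> clim v a.
Proof. by move=> /funext ->. Qed.

End ComplexLimit.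

(** An increasing sequence of Hilbert spaces without a common ambient space: for
    n <= m, tmap m n is an isometric embedding and tmap n m its adjoint, the
    orthogonal projection. Having one family of maps for both directions turns
    all the coherence conditions into tmap_comp. *)
Record hilbertTower (R : realType) := HilbertTower {
  tspace :> nat -> hilbertType R;
  tmap m n : {linear tspace n -> tspace m};
  tmap_id n x : tmap n n x = x;
  tmap_comp l m n x : (l <= m)%N || (n <= m)%N ->
    tmap l m (tmap m n x) = tmap l n x;
  tmap_adj m n x y : inner (tmap m n x) y = inner x (tmap n m y) }.
Arguments tmap {R} h m n.

Section Tower.
Context {R : realType} (X : hilbertTower R).

Lemma tmap_isometry m n x : (n <= m)%N -> rnorm (tmap X m n x) = rnorm x.
Proof.
move=> nm; apply: (pexpIrn (n := 2)); rewrite ?nnegrE ?rnorm_ge0 //.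
by rewrite !rnorm_sqrE tmap_adj tmap_comp ?nm ?orbT // tmap_id.
Qed.

(** For m <= n, expand the square of the distance from x to its projection. *)
Lemma tmap_contraction m n x : rnorm (tmap X m n x) <= rnorm x.
Proof.
have [nm|/ltnW mn] := leqP n m; first by rewrite tmap_isometry.
rewrite -(@ler_pXn2r _ 2) ?nnegrE ?rnorm_ge0 //.
have := sqr_ge0 (rnorm (x - tmap X n m (tmap X m n x))).
rewrite rnormB_sqr tmap_isometry // -tmap_adj -rnorm_sqrE; lra.
Qed.

Definition tprod := forall n, X n.
HB.instance Definition _ := gen_eqMixin tprod.
HB.instance Definition _ := gen_choiceMixin tprod.

Definition tprod_zero : tprod := fun n => 0.
Definition tprod_add (v w : tprod) : tprod := fun n => v n + w n.
Definition tprod_opp (v : tprod) : tprod := fun n => - v n.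
Definition tprod_scale (a : R[i]) (v : tprod) : tprod := fun n => a *: v n.

Fact tprod_addA : associative tprod_add.
Proof.
by move=> u v w; apply: functional_extensionality_dep => n; exact: addrA.
Qed.
Fact tprod_addC : commutative tprod_add.
Proof.
by move=> u v; apply: functional_extensionality_dep => n; exact: addrC.
Qed.
Fact tprod_add0 : left_id tprod_zero tprod_add.
Proof.
by move=> u; apply: functional_extensionality_dep => n; exact: add0r.
Qed.
Fact tprod_addN : left_inverse tprod_zero tprod_opp tprod_add.
Proof.
by move=> u; apply: functional_extensionality_dep => n; exact: addNr.
Qed.
HB.instance Definition _ := GRing.isZmodule.Build tprod
  tprod_addA tprod_addC tprod_add0 tprod_addN.

Fact tprod_scaleA a b v : tprod_scale a (tprod_scale b v) = tprod_scale (a * b) v.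
Proof. by apply: functional_extensionality_dep => n; exact: scalerA. Qed.
Fact tprod_scale1 : left_id 1 tprod_scale.
Proof.
by move=> u; apply: functional_extensionality_dep => n; exact: scale1r.
Qed.
Fact tprod_scaleDr : right_distributive tprod_scale +%R.
Proof.
by move=> a u v; apply: functional_extensionality_dep => n; exact: scalerDr.
Qed.
Fact tprod_scaleDl v : {morph tprod_scale^~ v: a b / a + b}.
Proof.
by move=> a b; apply: functional_extensionality_dep => n; exact: scalerDl.
Qed.
HB.instance Definition _ := GRing.Zmodule_isLmodule.Build R[i] tprod
  tprod_scaleA tprod_scale1 tprod_scaleDr tprod_scaleDl.

(** The sequences of projections of the vectors of the completed union. *)
Definition thread : {pred tprod} := fun v =>
  `[< (forall m n, (m <= n)%N -> tmap X m n (v n) = v m) /\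
      exists M, forall n, rnorm (v n) <= M >].

Fact thread_submod : submod_closed thread.
Proof.
split.
  apply/asboolP; split=> [m n _|]; first exact: linear0.
  by exists 0 => n; rewrite rnorm0.
move=> a u v /asboolP[uc [M uM]] /asboolP[vc [N vN]]; apply/asboolP; split.
  move=> m n mn; rewrite -[(a *: u + v) n]/(a *: u n + v n).
  by rewrite linearP uc // vc.
exists (complex.Re `|a| * M + N) => n.
rewrite -[(a *: u + v) n]/(a *: u n + v n).
apply: le_trans (rnormD _ _) _; rewrite rnormZ lerD // ler_wpM2l //.
have := normr_ge0 a; case: `|a| => x y; rewrite lecE /=; by case/andP.
Qed.

Record tlim := TLim { tcomp :> forall n, X n; _ : (tcomp : tprod) \in thread }.
HB.instance Definition _ := [isSub for tcomp].
HB.instance Definition _ := [Choice of tlim by <:].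
HB.instance Definition _ := GRing.SubChoice_isSubLmodule.Build R[i] tprod
  thread tlim thread_submod.

Implicit Types v w : tlim.

Lemma tcompD v w n : tcomp (v + w) n = v n + w n. Proof. by []. Qed.
Lemma tcompB v w n : tcomp (v - w) n = v n - w n. Proof. by []. Qed.
Lemma tcompZ a v n : tcomp (a *: v) n = a *: v n. Proof. by []. Qed.

Lemma tlim_eq v w : (forall n, v n = w n) -> v = w.
Proof. by move=> vw; apply: val_inj; exact: functional_extensionality_dep. Qed.

Lemma tmap_tcomp v m n : (m <= n)%N -> tmap X m n (v n) = v m.
Proof. by have /asboolP[vc _] := valP v; exact: vc. Qed.

Definition lnorm v : R := limn (fun n => rnorm (v n)).

(** A component is the projection of the later ones. *)
Lemma rnorm_tcomp_nd v : nondecreasing_seq (fun n => rnorm (v n)).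
Proof. by move=> m n mn; rewrite -(tmap_tcomp v mn); exact: tmap_contraction. Qed.

Lemma lnorm_cvg v : (fun n => rnorm (v n)) @ \oo --> lnorm v.
Proof.
apply: nondecreasing_is_cvgn; first exact: rnorm_tcomp_nd.
by have /asboolP[_ [M vM]] := valP v; exists M => _ [n _ <-].
Qed.

Arguments lnorm_cvg : clear implicits.

Lemma rnorm_tcomp_le v n : rnorm (v n) <= lnorm v.
Proof.
by apply: nondecreasing_cvgn_le; [exact: rnorm_tcomp_nd|exact: cvgP (lnorm_cvg v)].
Qed.

Lemma lnorm_le v M : (forall n, rnorm (v n) <= M) -> lnorm v <= M.
Proof.
by move=> vM; apply: (cvgr_to_le (lnorm_cvg v)); exact: nearW.
Qed.

Fact lnormD v w : lnorm (v + w) <= lnorm v + lnorm w.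
Proof.
apply: lnorm_le => n; rewrite tcompD.
by apply: le_trans (rnormD _ _) _; rewrite lerD // rnorm_tcomp_le.
Qed.

Fact lnormZ (a : R[i]) v : lnorm (a *: v) = complex.Re `|a| * lnorm v.
Proof.
apply: (cvg_unique _ (lnorm_cvg (a *: v))) => //.
have -> : (fun n => rnorm (tcomp (a *: v) n)) =
    (fun n => complex.Re `|a| * rnorm (v n)).
  by apply/funext => n; rewrite -rnormZ.
by apply: cvgMr; exact: lnorm_cvg.
Qed.

Fact lnorm_eq0 v : lnorm v = 0 -> v = 0.
Proof.
move=> v0; apply: tlim_eq => n; apply: rnorm_eq0; apply/eqP.
by rewrite eq_le rnorm_ge0 andbT -v0 rnorm_tcomp_le.
Qed.

Definition tlim_norm v : R[i] := (lnorm v)%:C%C.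

Fact tlim_normD v w : tlim_norm (v + w) <= tlim_norm v + tlim_norm w.
Proof. by rewrite /tlim_norm -rmorphD lecR lnormD. Qed.

Fact tlim_normZ (a : R[i]) v : tlim_norm (a *: v) = `|a| * tlim_norm v.
Proof. by rewrite /tlim_norm lnormZ rmorphM. Qed.

Fact tlim_norm_eq0 v : tlim_norm v = 0 -> v = 0.
Proof. by move=> /(@complexI R _ 0) /lnorm_eq0. Qed.

HB.instance Definition _ := Lmodule_isNormed.Build R[i] tlim
  tlim_normD tlim_normZ tlim_norm_eq0.

Lemma tlim_normE v : `|v| = (lnorm v)%:C%C.
Proof. by []. Qed.

Lemma norm_tcomp_le v n : `|v n| <= `|v|.
Proof. by rewrite rnormE tlim_normE lecR rnorm_tcomp_le. Qed.

Fact tmap_continuous m n : continuous (tmap X m n).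
Proof.
apply: bounded_linear_continuous; apply/linear_boundedP; near=> r => x.
apply: le_trans (_ : `|x| <= _).
  by rewrite !rnormE lecR tmap_contraction.
by rewrite ler_peMl ?normr_ge0.
Unshelve. all: by end_near. Qed.

(** A Cauchy filter converges in each component. Distances in the limit space
    are suprema of distances of components, so smallness passes to the limit
    uniformly in n. *)
Fact tlim_complete (F : set_system tlim) :
  ProperFilter F -> cauchy F -> cvg F.
Proof.
move=> FF /cauchy_ballP Fc.
pose ev n : tlim -> X n := fun v => v n.
have ev_cvg n : exists l : X n, ev n @ F --> l.
  suff /cauchy_cvg/cvg_ex[l Fl] : cauchy (ev n @ F) by exists l.
  apply/cauchy_ballP => e /Fc [[A B] /= [FA FB] AB].
  exists (ev n @` A, ev n @` B) => /=.
    by split; [move: FA|move: FB]; apply: filterS => x ?; exists x.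
  move=> _ [[x Ax <-] [y By <-]] /=.
  have := AB (x, y) (conj Ax By); rewrite -!ball_normE /=.
  exact: le_lt_trans (norm_tcomp_le (x - y) n).
pose l n : X n := sval (cid (ev_cvg n)).
have lE n : ev n @ F --> l n := svalP (cid (ev_cvg n)).
have small (e : R) : 0 < e -> exists2 A : set tlim, F A &
    forall v, A v -> forall n, rnorm (v n - l n) <= e.
  move=> e0; have eC : (0 : R[i]) < e%:C%C by rewrite ltcR.
  have [[A B] /= [FA FB] AB] := Fc _ eC.
  exists A => // v Av n; apply/ler_addgt0Pr => d d0.
  have dC : (0 : R[i]) < d%:C%C by rewrite ltcR.
  have Fl := (@cvgrPdist_lt _ _ _ F FF (ev n) (l n)).1 (lE n) _ dC.
  have [w [Bw /= lw]] := filter_ex (filterI FB Fl).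
  have -> : v n - l n = (v n - w n) + (w n - l n) by rewrite addrA subrK.
  apply: le_trans (rnormD _ _) _; apply: lerD.
    rewrite -tcompB; apply: le_trans (rnorm_tcomp_le _ _) _.
    have := AB (v, w) (conj Av Bw); rewrite -ball_normE /= tlim_normE ltcR.
    exact: ltW.
  by move: lw; rewrite rnormE ltcR rnormBC => /ltW.
have lT : (l : tprod) \in thread.
  apply/asboolP; split=> [m n mn|].
    have := continuous_cvg _ (@tmap_continuous m n (l n)) (lE n).
    have -> : tmap X m n \o ev n = ev m.
      by apply/funext => v /=; exact: tmap_tcomp.
    by move=> /(_ _) ml; apply: (cvg_unique _ ml (lE m)); exact: norm_hausdorff.
  have [A FA Al] := small 1 ltr01; have [v Av] := filter_ex FA.
  exists (lnorm v + 1) => n; rewrite -[l n](subKr (v n)).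
  apply: le_trans (rnormD _ _) _; rewrite rnormN lerD ?rnorm_tcomp_le //.
  exact: Al.
apply/cvg_ex; exists (TLim lT); apply/cvgrPdist_lt => e e0.
have [r r0 er] := gt0_complexE e0.
have [A FA Al] := small (r / 2) (divr_gt0 r0 (ltr0n _ 2)).
apply: filterS FA => v Av; rewrite distrC tlim_normE er ltcR.
apply: (@le_lt_trans _ _ (r / 2)); last by rewrite ltr_pdivrMr // ltr_pMr // ltr1n.
by apply: lnorm_le => n; rewrite tcompB; exact: Al.
Qed.

HB.instance Definition _ := Uniform_isComplete.Build tlim tlim_complete.

(** Polarization reduces the convergence of inner products to that of norms. *)
Fact Re_inner_cvg v w :
  exists l : R, (fun n => complex.Re (inner (v n) (w n))) @ \oo --> l.
Proof.
exists ((lnorm (v + w) ^+ 2 - lnorm v ^+ 2 - lnorm w ^+ 2) / 2).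
have -> : (fun n => complex.Re (inner (v n) (w n))) =
    (fun n => (rnorm (tcomp (v + w) n) ^+ 2 -
      rnorm (v n) ^+ 2 - rnorm (w n) ^+ 2) / 2).
  by apply/funext => n; rewrite tcompD rnormD_sqr; field.
have sqr_cvg x : (fun n => rnorm (tcomp x n) ^+ 2) @ \oo --> lnorm x ^+ 2.
  by apply: cvgM; exact: lnorm_cvg.
by apply: cvgMl; apply: cvgB => //; apply: cvgB.
Qed.

Fact inner_clim_ex v w : exists l, clim (fun n => inner (v n) (w n)) l.
Proof.
have [a va] := Re_inner_cvg v w; have [b vb] := Re_inner_cvg v ('i%C *: w).
exists (a +i* b)%C; split => //.
by under eq_fun do rewrite Im_inner.
Qed.

Definition linner v w : R[i] := sval (cid (inner_clim_ex v w)).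

Lemma linner_clim v w : clim (fun n => inner (v n) (w n)) (linner v w).
Proof. exact: svalP (cid (inner_clim_ex v w)). Qed.

Fact linner_bilinear : bilinear_for *%R (Num.conj \; *%R) linner.
Proof.
split=> [w a v v'|v a w w']; apply: clim_unique (linner_clim _ _) _.
  apply: eq_clim (climD (climZ a (linner_clim v w)) (linner_clim v' w)) => n.
  by rewrite tcompD tcompZ innerDl innerZl.
apply: eq_clim (climD (climZ (a^*) (linner_clim v w)) (linner_clim v w')) => n.
by rewrite tcompD tcompZ innerDr innerZr.
Qed.
HB.instance Definition _ := bilinear_isBilinear.Build R[i] tlim tlim R[i]
  *%R (Num.conj \; *%R) linner linner_bilinear.

Fact linner_herm v w : linner v w = (-1) ^+ false * Num.conj (linner w v).
Proof.
rewrite expr0 mul1r; apply: clim_unique (linner_clim v w) _.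
by apply: eq_clim (clim_conj (linner_clim w v)) => n; rewrite -innerC.
Qed.
HB.instance Definition _ := isHermitianSesquilinear.Build R[i] tlim false
  Num.conj linner linner_herm.

Fact linner_sqr v : `|v| ^+ 2 = linner v v.
Proof.
rewrite tlim_normE -rmorphXn /=.
apply: clim_unique (linner_clim v v); split => /=.
  under eq_fun do rewrite -rnorm_sqrE.
  by apply: cvgM; exact: lnorm_cvg.
under eq_fun do rewrite rnorm_sqr /=.
exact: cvg_cst.
Qed.

Fact linner_gt0 v : v != 0 -> 0 < linner v v.
Proof. by move=> v0; rewrite -linner_sqr exprn_gt0 // normr_gt0. Qed.
HB.instance Definition _ := isDotProduct.Build R[i] tlim linner linner_gt0.
HB.instance Definition _ := isHilbert.Build R tlim linner_sqr.

Lemma rnorm_tlim v : rnorm v = lnorm v.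
Proof. by rewrite /rnorm tlim_normE. Qed.

Fact thread_embed m (u : X m) : ((fun n => tmap X n m u) : tprod) \in thread.
Proof.
apply/asboolP; split=> [k n kn|]; first by rewrite tmap_comp ?kn.
by exists (rnorm u) => n; exact: tmap_contraction.
Qed.

Definition embed m (u : X m) : tlim := TLim (thread_embed u).

Fact embed_linear m : linear (@embed m).
Proof. by move=> a u v; apply: tlim_eq => n; rewrite /= linearP. Qed.
HB.instance Definition _ m := GRing.isLinear.Build R[i] (X m) tlim _ (@embed m)
  (@embed_linear m).

Lemma embedE m (u : X m) n : embed u n = tmap X n m u.
Proof. by []. Qed.

(** The sequence that defines the inner product is constant from n = m on. *)
Lemma inner_embed m v (u : X m) : inner v (embed u) = inner (v m) u.
Proof.
apply: clim_unique (linner_clim v (embed u)) _; split.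
  apply: cvg_near_cst; near=> n; rewrite embedE -tmap_adj tmap_tcomp //.
  by near: n; exact: nbhs_infty_ge.
apply: cvg_near_cst; near=> n; rewrite embedE -tmap_adj tmap_tcomp //.
by near: n; exact: nbhs_infty_ge.
Unshelve. all: by end_near. Qed.

Lemma inner_embed2 m (u w : X m) : inner (embed u) (embed w) = inner u w.
Proof. by rewrite inner_embed embedE tmap_id. Qed.

(** Pythagoras: the square of the distance from v to its n-th projection is
    |v|^2 - |v_n|^2, and |v_n| tends to |v|. *)
Lemma embed_dense v (e : R) : 0 < e ->
  exists m, forall n, (m <= n)%N -> rnorm (v - embed (v n)) < e.
Proof.
move=> e0.
have sq n : rnorm (v - embed (v n)) ^+ 2 = lnorm v ^+ 2 - rnorm (v n) ^+ 2.
  rewrite rnormB_sqr inner_embed rnorm_tlim -rnorm_sqrE.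
  by rewrite [rnorm (embed _) ^+ 2]rnorm_sqrE inner_embed2 -rnorm_sqrE; ring.
have : (fun n => rnorm (v n) ^+ 2) @ \oo --> lnorm v ^+ 2.
  by apply: cvgM; exact: lnorm_cvg.
move=> /cvgrPdist_lt /(_ (e ^+ 2) (exprn_gt0 _ e0)) [m _ mP].
exists m => n mn; rewrite -(@ltr_pXn2r _ 2) ?nnegrE ?rnorm_ge0 ?ltW // sq.
exact: le_lt_trans (ler_norm _) (mP n mn).
Qed.

End Tower.

(** * The representation carried by the limit *)

Section LimitRepresentation.
Context {R : realType} (T : catRep R) (hT : star_representation T).

Let op (m n : nat) (x : G) : {linear rspace T n -> rspace T m} :=
  rop T (mor_of n m x).

Let opM l m n x y u : op l m x (op m n y u) =
  rop T (mor_comp (mor_of m l x) (mor_of n m y)) u.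
Proof. by have [-> _ _] := hT. Qed.

Let op_adj m n x u w : inner (op m n x u) w = inner u (op n m x^-1%g w).
Proof. by have [_ -> _] := hT; rewrite mor_starE. Qed.

Fact op_id n u : op n n 1%g u = u.
Proof. by have [_ _ ->] := hT. Qed.

Fact op1_comp l m n u : (l <= m)%N || (n <= m)%N ->
  op l m 1%g (op m n 1%g u) = op l n 1%g u.
Proof. by move=> lmn; rewrite opM mor_comp_embed. Qed.

Fact op1_adj m n u w : inner (op m n 1%g u) w = inner u (op n m 1%g w).
Proof. by rewrite op_adj invg1. Qed.

(** The double cosets of the unit are the embeddings and projections of the
    tower. *)
Definition rep_tower : hilbertTower R := HilbertTower op_id op1_comp op1_adj.

Let tmapE m n u : tmap rep_tower m n u = op m n 1%g u. Proof. by []. Qed.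
Implicit Types v w : tlim rep_tower.

Let op_contraction m n x u : (forall k, K n k -> K m (x * k * x^-1)%g) ->
  rnorm (op m n x u) <= rnorm u.
Proof.
move=> xnm; have E u' : op m n x (op n m x^-1%g u') = u'.
  by rewrite opM mor_comp_conj // mulgV op_id.
rewrite -(@ler_pXn2r _ 2) ?nnegrE ?rnorm_ge0 //.
have := sqr_ge0 (rnorm (u - op n m x^-1%g (op m n x u))).
rewrite rnormB_sqr -op_adj -rnorm_sqrE.
have -> : rnorm (op n m x^-1%g (op m n x u)) ^+ 2 = rnorm (op m n x u) ^+ 2.
  by rewrite !rnorm_sqrE op_adj invgK E.
lra.
Qed.

Let conj_index g m := sval (cid (conj_sub_ex g m)).
Let conj_indexP g m : conj_sub g m (conj_index g m) :=
  svalP (cid (conj_sub_ex g m)).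
Let appr g n := sval (cid (approx_ex g n)).
Let apprP g n : approximates g n (appr g n) := svalP (cid (approx_ex g n)).

Definition act_comp (g : trisym) v : tprod rep_tower :=
  fun m => op m (conj_index g m) (appr g (conj_index g m)) (v (conj_index g m)).

(** v_n is the projection of v_n' for n <= n', and projecting before applying x
    changes nothing, as the product of the double cosets of x and of 1 is that
    of x. *)
Lemma op_tcomp g m n n' x y v : conj_sub g m n -> conj_sub g m n' ->
  approximates g n x -> approximates g n' y -> op m n x (v n) = op m n' y (v n').
Proof.
wlog nn' : n n' x y / (n <= n')%N => [W|gn _ gx gy].
  by have [nn'|/ltnW nn'] := leqP n n' => ? ? ? ?; [|symmetry]; apply: W.
rewrite -(tmap_tcomp v nn') tmapE opM.
rewrite mor_comp_conj ?mulg1; last exact: conj_sub_approx gn gx.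
by rewrite (mor_of_approx n' gn gx (approx_leq nn' gy)).
Qed.

Lemma act_compE g m n x v : conj_sub g m n -> approximates g n x ->
  act_comp g v m = op m n x (v n).
Proof.
by move=> gn gx; exact: op_tcomp v (@conj_indexP g m) gn (apprP _ _) gx.
Qed.

Fact act_thread g v : act_comp g v \in @thread R rep_tower.
Proof.
apply/asboolP; split=> [l m lm|].
  have gm := @conj_indexP g m; have gx := apprP g (conj_index g m).
  rewrite (act_compE v gm gx) (act_compE v (conj_sub_leq lm (leqnn _) gm) gx).
  rewrite tmapE opM mor_comp_conj ?mul1g //.
  by move=> k /(K_leq lm); rewrite mul1g invg1 mulg1.
exists (lnorm v) => m; apply: le_trans (rnorm_tcomp_le v (conj_index g m)).
by apply: op_contraction; exact: conj_sub_approx (@conj_indexP g m) (apprP _ _).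
Qed.

Definition lim_act g v : tlim rep_tower := TLim (act_thread g v).

Lemma lim_actE g m n x v : conj_sub g m n -> approximates g n x ->
  lim_act g v m = op m n x (v n).
Proof. exact: act_compE. Qed.

Fact lim_act_linear g : linear (lim_act g).
Proof.
move=> a v w; apply: tlim_eq => m.
have gm := @conj_indexP g m; have gx := apprP g (conj_index g m).
by rewrite tcompD tcompZ !(lim_actE _ gm gx) tcompD tcompZ linearP.
Qed.
HB.instance Definition _ g := GRing.isLinear.Build R[i] (tlim rep_tower)
  (tlim rep_tower) _ (lim_act g) (lim_act_linear g).

Lemma lim_act1 v : lim_act 1%g v = v.
Proof.
apply: tlim_eq => m; rewrite (@lim_actE _ m m 1%g) ?op_id //.
  by move=> k; rewrite mul1g invg1 mulg1.
by rewrite -trisym_of_G1; exact: approx_of_G.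
Qed.

(** The approximant x of g is chosen so fine that x y still approximates g h;
    the products of double cosets are then the plain ones. *)
Lemma lim_actM g h v : lim_act (g * h)%g v = lim_act g (lim_act h v).
Proof.
apply: tlim_eq => l.
have [m glm] := conj_sub_ex g l; have [n hmn] := conj_sub_ex h m.
have [m' hnm] := conj_sub_ex h^-1%g n.
pose M := maxn m m'.
have [x gx] := approx_ex g M; have [y hy] := approx_ex h n.
have gxm : approximates g m x by apply: approx_leq gx; exact: leq_maxl.
have ghxy : approximates (g * h)%g n (x * y)%g.
  by apply: approxM gx _ hy; apply: conj_sub_leq hnm; rewrite ?leq_maxr.
rewrite (lim_actE _ (conj_subM glm hmn) ghxy) (lim_actE _ glm gxm).
rewrite (lim_actE _ hmn hy) opM mor_comp_conj //.
exact: conj_sub_approx glm gxm.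
Qed.

Lemma lim_act_contraction g v : lnorm (lim_act g v) <= lnorm v.
Proof.
apply: lnorm_le => m.
have gm := @conj_indexP g m; have gx := apprP g (conj_index g m).
rewrite (lim_actE _ gm gx); apply: le_trans (rnorm_tcomp_le v (conj_index g m)).
by apply: op_contraction; exact: conj_sub_approx gm gx.
Qed.

Lemma lim_act_unitary g : unitary (lim_act g).
Proof.
have actK h : cancel (lim_act h) (lim_act h^-1%g).
  by move=> v; rewrite -lim_actM mulVg lim_act1.
split; last first.
  by move=> v; exists (lim_act g^-1%g v); rewrite /= -lim_actM mulgV lim_act1.
apply: isometry_inner => v; rewrite !rnorm_tlim; apply/eqP.
rewrite eq_le lim_act_contraction /= -{1}(actK g v).
exact: lim_act_contraction.
Qed.

(** On V_m an approximant x at level m acts as g itself, though g need not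
    conjugate tK m into tK l: embed u in a higher level first. *)
Lemma lim_act_embedE g l m x (u : rep_tower m) : approximates g m x ->
  lim_act g (embed u) l = op l m x u.
Proof.
move=> gx; have [n gln] := conj_sub_ex g l; pose M := maxn n m.
have [y gy] := approx_ex g M.
rewrite (lim_actE _ (conj_sub_leq (leqnn l) (leq_maxl n m) gln) gy) embedE.
rewrite tmapE opM mor_comp_id ?leq_maxr //.
by rewrite (mor_of_approx_right l (approx_leq (leq_maxr n m) gy) gx).
Qed.

Lemma lim_act_embed m k (u : rep_tower m) : tK m k ->
  lim_act k (embed u) = embed u.
Proof.
move=> km; apply: tlim_eq => l; rewrite (@lim_act_embedE _ _ _ 1%g) //.
by rewrite /approximates trisym_of_G1 mulg1; exact: tKV.
Qed.

Lemma rnorm_lim_act g v : rnorm (lim_act g v) = rnorm v.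
Proof. by rewrite /rnorm (unitary_norm _ (lim_act_unitary g)). Qed.

(** In the l-th component, T([1]_(l,m)) v_m is the action of theta_j[m] on an
    approximation of v, while v_l is its action on v itself. *)
Lemma lim_act_fixed m v : (forall k, tK m k -> lim_act k v = v) ->
  v = embed (v m).
Proof.
move=> vfix; apply: tlim_eq => l; apply/eqP; rewrite -subr_eq0; apply/eqP.
apply: rnorm_eq0; apply/eqP; rewrite eq_le rnorm_ge0 andbT.
apply/ler_addgt0Pr => e e0; rewrite add0r.
have [n0 nP] := embed_dense v e0; pose n := maxn m n0.
have [j jE] := mor_comp_theta l m n.
have vn : embed (v m) l = lim_act (trisym_of_G (theta j m)) (embed (v n)) l.
  rewrite (lim_act_embedE _ _ (approx_of_G n (theta j m))) embedE.
  rewrite -(tmap_tcomp v (leq_maxl m n0)) -/n.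
  by rewrite !tmapE opM jE.
have vl : v l = lim_act (trisym_of_G (theta j m)) v l.
  by rewrite vfix //; apply: trisym_of_GK; exact: K_theta.
rewrite {1}vl vn -tcompB -linearB.
apply: le_trans (rnorm_tcomp_le _ _) _.
by rewrite -rnorm_tlim rnorm_lim_act ltW // nP // leq_maxr.
Qed.

(** On a dense set of vectors the orbit map is locally constant; unitarity makes
    the approximation uniform in g. *)
Lemma lim_act_continuous v w :
  continuous (fun g : trisym => inner (lim_act g v) w : (R[i])^o).
Proof.
move=> g; apply/(@cvgrPdist_lt _ _ _ _ (nbhs_filter g)) => e0 e0_gt0.
have [e e_gt0 ->] := gt0_complexE e0_gt0.
pose d := e / (2 * (rnorm w + 1)).
have w1 : 0 < rnorm w + 1 by rewrite ltr_wpDl ?rnorm_ge0.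
have d_gt0 : 0 < d by rewrite divr_gt0 // mulr_gt0.
have [m mP] := embed_dense v d_gt0.
apply/trisym_nbhsP; exists m => k km /=.
rewrite -innerBl lim_actM -linearB; apply: le_lt_trans (inner_le _ _) _.
rewrite ltcR rnorm_lim_act; set p := embed (v m).
have -> : v - lim_act k v = (v - p) - lim_act k (v - p).
  by rewrite linearB /= (lim_act_embed _ km : lim_act k p = p) opprB addrA subrK.
have vp : rnorm (v - p) < d by exact: mP.
apply: (@le_lt_trans _ _ ((rnorm (v - p) + rnorm (v - p)) * (rnorm w + 1))).
  apply: ler_pM; rewrite ?rnorm_ge0 ?lerDl //.
  by apply: le_trans (rnormD _ _) _; rewrite rnormN rnorm_lim_act.
rewrite -ltr_pdivlMr //; apply: (@lt_le_trans _ _ (d + d)); first exact: ltrD.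
by rewrite /d le_eqVlt; apply/orP; left; apply/eqP; field; rewrite gt_eqF.
Qed.

Definition limit_rep : unitaryRep R :=
  UnitaryRep lim_act_unitary lim_act1 lim_actM lim_act_continuous.

Fact embed_fixed m (u : rep_tower m) :
  (embed u : uspace limit_rep) \in fixed_space limit_rep m.
Proof. by apply/asboolP => k; exact: lim_act_embed. Qed.

Definition embed_fix m (u : rspace T m) : rspace (tilde limit_rep) m :=
  @CSpace _ _ (fixed_space limit_rep m) _ (embed_fixed u).

Fact embed_fix_linear m : linear (@embed_fix m).
Proof. by move=> a u w; apply: val_inj; rewrite /= linearP. Qed.
HB.instance Definition _ m := GRing.isLinear.Build R[i] (rspace T m)
  (rspace (tilde limit_rep) m) _ (@embed_fix m) (@embed_fix_linear m).

Lemma embed_fix_surj m (y : rspace (tilde limit_rep) m) :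
  exists x, embed_fix x = y.
Proof.
exists (cval y m); apply: val_inj; apply/esym; apply: lim_act_fixed => k km.
exact: (@fixedP _ limit_rep m y k km).
Qed.

Lemma limit_rep_equiv : catRep_equiv T (tilde limit_rep).
Proof.
exists (fun m => @embed_fix m); split=> [m|m n P u].
  split=> [u w|]; [exact: inner_embed2|exact: embed_fix_surj].
have [p Pp] := mor_ex P; rewrite (tildeE _ Pp).
apply/esym; apply: proj_unique => z; have [w <-] := embed_fix_surj z.
apply/eqP; rewrite innerBl subr_eq0; apply/eqP.
rewrite [LHS]inner_embed [RHS]inner_embed2.
rewrite [X in inner X _](lim_act_embedE _ _ (approx_of_G n p)).
by congr (inner (rop T _ u) w); apply: mor_eq; rewrite (dcosetP Pp).
Qed.

End LimitRepresentation.

(** * Vectors of least norm in a Hilbert space *)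

Section HilbertSequences.
Context {R : realType} {H : hilbertType R}.

Lemma rnorm_cauchy_cvg (u : nat -> H) :
  (forall e, 0 < e -> exists N, forall m n, (N <= m)%N -> (N <= n)%N ->
    rnorm (u m - u n) < e) ->
  exists l, forall e, 0 < e ->
    exists N, forall n, (N <= n)%N -> rnorm (l - u n) < e.
Proof.
move=> uC.
have /cauchy_cvg/cvg_ex[l ul] : cauchy (u @ \oo).
  apply/cauchy_ballP => e0 e0_gt0.
  have [e e_gt0 ->] := gt0_complexE e0_gt0.
  have [N NP] := uC e e_gt0.
  pose A := u @` [set n | (N <= n)%N].
  have NN : (u @ \oo) A by exists N => // n /= Nn; exists n.
  exists (A, A) => //=.
  move=> _ [[m /= Nm <-] [n /= Nn <-]]; rewrite -ball_normE /= rnormE ltcR.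
  exact: NP.
exists l => e e0; have eC : (0 : R[i]) < e%:C%C by rewrite ltcR.
have [N _ NP] := (@cvgrPdist_lt _ _ _ \oo _ u l).1 ul _ eC.
by exists N => n Nn; have := NP n Nn; rewrite /= rnormE ltcR.
Qed.

(** The parallelogram identity makes minimizing sequences Cauchy and the
    minimizer unique. *)
Lemma min_norm_ex (C : set H) : C !=set0 ->
  (forall u w, C u -> C w -> C (2^-1 *: (u + w))) ->
  (forall c, (forall e, 0 < e -> exists2 w, C w & rnorm (c - w) < e) -> C c) ->
  exists2 c, C c & forall w, C w -> rnorm w <= rnorm c -> w = c.
Proof.
move=> [w0 Cw0] Cmid Ccl.
pose D := inf (@rnorm R H @` C).
have hinf : has_inf (@rnorm R H @` C).
  split; first by exists (rnorm w0), w0.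
  by exists 0 => _ [w _ <-]; exact: rnorm_ge0.
have Dle w : C w -> D <= rnorm w.
  by move=> Cw; apply: ge_inf; [exact: hinf.2|exists w].
have D0 : 0 <= D.
  by apply: lb_le_inf; [exact: hinf.1|move=> _ [w _ <-]; exact: rnorm_ge0].
have close u w e : C u -> C w -> rnorm u <= D + e -> rnorm w <= D + e -> 0 <= e ->
    rnorm (u - w) ^+ 2 <= 4 * e * (2 * D + e).
  move=> Cu Cw ue we e0.
  have := Dle _ (Cmid u w Cu Cw).
  have -> : (2^-1 : R[i]) = (2^-1 : R)%:C%C by rewrite fmorphV /= rmorphMn.
  rewrite rnormZr ?invr_ge0 // => mid.
  have E := rnorm_par u w.
  have u0 := rnorm_ge0 u; have v0 := rnorm_ge0 w.
  have su : rnorm u ^+ 2 <= (D + e) ^+ 2 by rewrite ler_pXn2r // nnegrE addr_ge0.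
  have sw : rnorm w ^+ 2 <= (D + e) ^+ 2 by rewrite ler_pXn2r // nnegrE addr_ge0.
  have sm : (2 * D) ^+ 2 <= rnorm (u + w) ^+ 2.
    rewrite ler_pXn2r ?nnegrE ?rnorm_ge0 ?mulr_ge0 //; lra.
  rewrite exprMn in sm; nra.
have wex n : exists w, C w /\ rnorm w < D + n.+1%:R^-1.
  have [|_ [w Cw <-] wD] := @inf_adherent _ _ (n.+1%:R^-1) _ hinf.
    by rewrite invr_gt0.
  by exists w.
pose u n := sval (cid (wex n)).
have uP n : C (u n) /\ rnorm (u n) < D + n.+1%:R^-1 := svalP (cid (wex n)).
have uD e : 0 < e -> exists N, forall n, (N <= n)%N -> rnorm (u n) <= D + e.
  move=> e0; have [N _ NP] := near_infty_natSinv_lt (PosNum e0).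
  exists N => n Nn; apply: ltW; apply: lt_trans (uP n).2 _.
  by rewrite ltrD2l; exact: NP.
have [|c cu] := @rnorm_cauchy_cvg u.
  move=> e e0.
  (* chosen so that the bound 4 d (2 D + d) of close is less than e ^+ 2 *)
  pose d := Num.min 1 (e ^+ 2 / (8 * (2 * D + 1))).
  have D1 : 0 < 8 * (2 * D + 1) by rewrite mulr_gt0 //; lra.
  have d0 : 0 < d by rewrite lt_min ltr01 divr_gt0 ?exprn_gt0.
  have [N NP] := uD d d0; exists N => m n Nm Nn.
  rewrite -(@ltr_pXn2r _ 2) ?nnegrE ?rnorm_ge0 ?ltW //.
  apply: le_lt_trans
    (close _ _ d (uP m).1 (uP n).1 (NP m Nm) (NP n Nn) (ltW d0)) _.
  have d1 : d <= 1 by rewrite ge_min lexx.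
  have : d <= e ^+ 2 / (8 * (2 * D + 1)) by rewrite ge_min lexx orbT.
  rewrite ler_pdivlMr // => de.
  have := exprn_gt0 2 e0; nra.
have Cc : C c.
  apply: Ccl => e e0; have [N NP] := cu e e0.
  by exists (u N); [exact: (uP N).1|exact: NP].
have cD : rnorm c <= D.
  apply/ler_addgt0Pr => e e0; have e2 : 0 < e / 2 by rewrite divr_gt0.
  have [N NP] := cu _ e2; have [M MP] := uD _ e2.
  have NM := NP _ (leq_maxl N M); have MN := MP _ (leq_maxr N M).
  rewrite -[c](subrK (u (maxn N M))); apply: le_trans (rnormD _ _) _; lra.
exists c => // w Cw wc; apply/eqP; rewrite -subr_eq0; apply/eqP/rnorm_eq0/eqP.
rewrite -sqrf_eq0 eq_le sqr_ge0 andbT.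
apply: le_trans (close w c 0 Cw Cc _ _ _) _ => //.
- by rewrite addr0 (le_trans wc).
- by rewrite addr0.
by rewrite mulr0 mul0r.
Qed.

End HilbertSequences.

(** * Recovering a representation from its compressions *)

Local Notation fixproj rho m := (Defs.proj (fixed_space rho m)).

Section FixedVectors.
Context {R : realType} (rho : unitaryRep R).
Implicit Types (v w : uspace rho).

Lemma rnorm_uact g v : rnorm (rho g v) = rnorm v.
Proof. by rewrite /rnorm (unitary_norm _ (uact_unitary rho g)). Qed.

Lemma inner_uact g v w : inner (rho g v) w = inner v (rho g^-1%g w).
Proof.
by rewrite -(uact_unitary rho g^-1%g).1 -uactM mulVg uact1.
Qed.

Lemma uact_fixed_near v (e : R) : 0 < e ->
  exists m, forall k, tK m k -> `|inner v v - inner (rho k v) v| < e%:C%C.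
Proof.
move=> e0; have eC : (0 : R[i]) < e%:C%C by rewrite ltcR.
have := @uact_continuous _ rho v v 1%g.
move/(@cvgrPdist_lt _ _ _ _ (nbhs_filter (1%g : trisym))) => /(_ _ eC).
move=> /trisym_nbhsP[m mP].
by exists m => k km; have := mP k km; rewrite /= mul1g uact1.
Qed.

(** A closed convex set invariant under tK m contains a fixed vector, its
    element of least norm. By continuity there is such a set strictly on one
    side of the hyperplane orthogonal to v. *)
Lemma fixed_total v :
  (forall m (z : cspace (fixed_space rho m)), inner v (cval z) = 0) -> v = 0.
Proof.
move=> vperp; apply: contrapT => v0.
have nv : 0 < rnorm v ^+ 2.
  rewrite exprn_gt0 // lt_neqAle eq_sym rnorm_ge0 andbT.
  by apply/eqP => /rnorm_eq0.
(* C is closed and convex as an intersection of preimages of a half-space. *)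
pose s := rnorm v ^+ 2 / 2.
have s0 : 0 < s by rewrite divr_gt0.
have [m mP] := uact_fixed_near v s0.
pose C := [set w | forall k, tK m k -> s <= complex.Re (inner (rho k w) v)].
have [|u w Cu Cw k km|c cC|c Cc cmin] := @min_norm_ex _ _ C.
- exists v => k /mP; rewrite rnorm_sqr => /(le_lt_trans (normc_ge_Re _)).
  rewrite ltcR raddfB /= => /(le_lt_trans (ler_norm _)).
  rewrite /s; lra.
- rewrite linearZ linearD /= innerZl innerDl.
  have -> : (2^-1 : R[i]) = (2^-1 : R)%:C%C by rewrite fmorphV /= rmorphMn.
  rewrite ReZ raddfD /=.
  have := Cu k km; have := Cw k km; lra.
- move=> k km; apply/ler_addgt0Pr => e e0.
  have w1 : 0 < rnorm v + 1 by rewrite ltr_wpDl ?rnorm_ge0.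
  have [w Cw cw] := cC _ (divr_gt0 e0 w1).
  have := Re_inner_le (rho k (w - c)) v.
  rewrite linearB innerBl raddfB /= -linearB rnorm_uact rnormBC.
  have := Cw k km; have := rnorm_ge0 v; have := rnorm_ge0 (c - w).
  move: cw; rewrite ltr_pdivlMr //; nra.
have cfix k : tK m k -> rho k c = c.
  move=> km; apply: cmin; last by rewrite rnorm_uact.
  move=> k' km'; rewrite -uactM; apply: Cc; exact: tKM.
have cF : c \in fixed_space rho m by apply/asboolP.
have := Cc _ (tK1 m); rewrite cfix; last exact: tK1.
by rewrite Re_innerC (vperp m (CSpace cF)) /= leNgt s0.
Qed.

Lemma proj_eq m v v' : (forall z : cspace (fixed_space rho m),
    inner v (cval z) = inner v' (cval z)) ->
  fixproj rho m v = fixproj rho m v'.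
Proof.
by move=> vv; apply: proj_unique => z; rewrite innerBl inner_proj vv subrr.
Qed.

Lemma fixed_leq m n v : (m <= n)%N ->
  v \in fixed_space rho m -> v \in fixed_space rho n.
Proof.
by move=> mn /asboolP vm; apply/asboolP => k kn; apply: vm; exact: tK_leq kn.
Qed.

Lemma proj_proj m n v : (m <= n)%N ->
  fixproj rho m (cval (fixproj rho n v)) = fixproj rho m v.
Proof.
move=> mn; apply: proj_eq => z.
exact: inner_proj v (CSpace (fixed_leq mn (valP z))).
Qed.

Lemma rnorm_proj_le m v : rnorm (cval (fixproj rho m v)) <= rnorm v.
Proof. by rewrite -lecR -!rnormE; exact: norm_proj_le. Qed.

(** The increments of a coherent family are orthogonal to its earlier members,
    so a bounded one is Cauchy. *)
Lemma fixed_thread_cvg (w : forall m, cspace (fixed_space rho m)) (M : R) :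
  (forall m n, (m <= n)%N -> fixproj rho m (cval (w n)) = w m) ->
  (forall m, rnorm (cval (w m)) <= M) ->
  exists v, (forall m, fixproj rho m v = w m) /\
    forall e, 0 < e -> exists N, forall n, (N <= n)%N -> rnorm (v - cval (w n)) < e.
Proof.
move=> wc wM.
have inn m n (z : cspace (fixed_space rho m)) : (m <= n)%N ->
    inner (cval (w n)) (cval z) = inner (cval (w m)) (cval z).
  by move=> mn; rewrite -inner_proj wc.
have sq m n : (m <= n)%N -> rnorm (cval (w n) - cval (w m)) ^+ 2 =
    rnorm (cval (w n)) ^+ 2 - rnorm (cval (w m)) ^+ 2.
  by move=> mn; rewrite rnormB_sqr inn // -rnorm_sqrE; ring.
pose a n := rnorm (cval (w n)) ^+ 2.
have a_nd : nondecreasing_seq a.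
  by move=> m n mn; rewrite -subr_ge0 -sq // sqr_ge0.
have a_cvg : cvgn a.
  apply: nondecreasing_is_cvgn => //; exists (M ^+ 2) => _ [n _ <-].
  by rewrite ler_pXn2r ?nnegrE ?rnorm_ge0 // (le_trans (rnorm_ge0 _) (wM n)).
have a_le n : a n <= limn a by exact: nondecreasing_cvgn_le.
have [|v vw] := @rnorm_cauchy_cvg _ _ (fun n => cval (w n)).
  move=> e e0; have e2 : 0 < e ^+ 2 by rewrite exprn_gt0.
  have [N _ NP] := (@cvgrPdist_lt _ _ _ \oo _ a (limn a)).1 a_cvg _ e2.
  exists N; have sorted_close m n : (N <= m)%N -> (m <= n)%N ->
      rnorm (cval (w n) - cval (w m)) < e.
    move=> Nm mn; rewrite -(@ltr_pXn2r _ 2) ?nnegrE ?rnorm_ge0 ?ltW // sq //.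
    rewrite -/(a n) -/(a m); have := NP m Nm; have := a_le n.
    by move=> an /(le_lt_trans (ler_norm _)); lra.
  move=> m n Nm Nn; have [mn|/ltnW nm] := leqP m n; last exact: sorted_close.
  by rewrite rnormBC sorted_close.
exists v; split => // m; apply: proj_unique => z.
apply: normr0_eq0; apply/eqP; rewrite eq_le normr_ge0 andbT.
pose c := inner (v - cval (w m)) (cval z); rewrite -/c.
have cE : `|c| = (complex.Re `|c|)%:C%C by exact/ge0_complexE/normr_ge0.
rewrite cE lecR; apply/ler_addgt0Pr => e e0; rewrite add0r -lecR -cE.
have z1 : 0 < rnorm (cval z) + 1 by rewrite ltr_wpDl ?rnorm_ge0.
have [N NP] := vw _ (divr_gt0 e0 z1).
pose n := maxn N m; have := NP n (leq_maxl N m) => vn.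
have -> : c = inner (v - cval (w n)) (cval z).
  by rewrite /c !innerBl (inn m n) // leq_maxr.
apply: le_trans (inner_le _ _) _; rewrite lecR.
move: vn; rewrite ltr_pdivlMr // => vn; have := rnorm_ge0 (v - cval (w n)); nra.
Qed.

Lemma proj_cvg v (e : R) : 0 < e ->
  exists N, forall n, (N <= n)%N -> rnorm (v - cval (fixproj rho n v)) < e.
Proof.
have [||v' [v'E v'cvg]] := @fixed_thread_cvg (fun m => fixproj rho m v) (rnorm v).
- by move=> m n; exact: proj_proj.
- by move=> m; exact: rnorm_proj_le.
move=> e0; suff vv' : v = v' by have := v'cvg e e0; rewrite -vv'.
apply/eqP; rewrite -subr_eq0; apply/eqP/fixed_total => m z.
by rewrite innerBl -(inner_proj v z) -(inner_proj v' z) v'E subrr.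
Qed.

(** Pair with a fixed vector z and move g to the other side: g^-1 z is fixed by
    tK n, so only the projection of v at level n is seen. *)
Lemma proj_uact g m n x v : conj_sub g m n -> approximates g n x ->
  fixproj rho m (rho (trisym_of_G x) (cval (fixproj rho n v))) =
  fixproj rho m (rho g v).
Proof.
move=> gmn gx; set p := fixproj rho n v.
have -> : rho (trisym_of_G x) (cval p) = rho g (cval p).
  rewrite -[in RHS](fixedP p gx) -uactM; congr (rho _ _).
  by rewrite mulVKg.
apply: proj_eq => z; rewrite !inner_uact.
have zF : rho g^-1%g (cval z) \in fixed_space rho n.
  apply/asboolP => k kn; rewrite -{2}(fixedP z (gmn k kn)) -!uactM.
  by rewrite !mulgA mulVg mul1g.
exact: inner_proj v (CSpace zF).
Qed.

End FixedVectors.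

Section Uniqueness.
Context {R : realType} (T : catRep R).

(** v1 and v2 have the same coordinates in T. This relation is the graph of the
    equivalence of the two representations. *)
Definition compatible (rho1 rho2 : unitaryRep R)
  (W1 : forall m, {linear rspace T m -> rspace (tilde rho1) m})
  (W2 : forall m, {linear rspace T m -> rspace (tilde rho2) m}) v1 v2 : Prop :=
  forall m, exists u, W1 m u = fixproj rho1 m v1 /\
                      W2 m u = fixproj rho2 m v2.

Definition intertwiner (rho : unitaryRep R)
    (W : forall m, {linear rspace T m -> rspace (tilde rho) m}) : Prop :=
  (forall m, unitary (W m)) /\
  forall m n (P : mor n m) x, W m (rop T P x) = rop (tilde rho) P (W n x).

Section TwoRepresentations.
Context (rho1 rho2 : unitaryRep R)
  (W1 : forall m, {linear rspace T m -> rspace (tilde rho1) m})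
  (W2 : forall m, {linear rspace T m -> rspace (tilde rho2) m})
  (W1i : intertwiner W1) (W2i : intertwiner W2).

(** Norms are limits of the norms of projections, which agree. *)
Lemma compatible_norm_le v1 v2 : compatible W1 W2 v1 v2 -> rnorm v1 <= rnorm v2.
Proof.
move=> v12; apply/ler_addgt0Pr => e e0.
have [N NP] := proj_cvg v1 e0; have [u [u1 u2]] := v12 N.
rewrite -[v1](subrK (cval (fixproj rho1 N v1))) addrC.
apply: le_trans (rnormD _ _) _; apply: lerD; last exact/ltW/NP.
rewrite -u1 -lecR -rnormE -[`|_|]/`|W1 N u| (unitary_norm u (W1i.1 N)).
rewrite -(unitary_norm u (W2i.1 N)) u2 -[`|_|]/`|cval (fixproj rho2 N v2)|.
by rewrite rnormE lecR rnorm_proj_le.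
Qed.

Lemma compatible_linear a v1 v2 w1 w2 : compatible W1 W2 v1 v2 ->
  compatible W1 W2 w1 w2 -> compatible W1 W2 (a *: v1 + w1) (a *: v2 + w2).
Proof.
move=> v12 w12 m; have [u [u1 u2]] := v12 m; have [u' [u1' u2']] := w12 m.
by exists (a *: u + u'); rewrite !linearP u1 u2 u1' u2'.
Qed.

Lemma compatible_act g v1 v2 : compatible W1 W2 v1 v2 ->
  compatible W1 W2 (rho1 g v1) (rho2 g v2).
Proof.
move=> v12 m; have [n gmn] := conj_sub_ex g m; have [x gx] := approx_ex g n.
have [u [u1 u2]] := v12 n; exists (rop T (mor_of n m x) u).
by rewrite W1i.2 W2i.2 !(tildeE _ (mor_self n m x)) u1 u2 !(proj_uact _ gmn gx).
Qed.

(** The coordinates of v1 give a bounded coherent family of fixed vectors of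
    rho2, because coherence is expressed by the operators of T. *)
Lemma compatible_total v1 : exists v2, compatible W1 W2 v1 v2.
Proof.
pose u m := sval (cid ((W1i.1 m).2 (fixproj rho1 m v1))).
have uE m : W1 m (u m) = fixproj rho1 m v1 :=
  svalP (cid ((W1i.1 m).2 (fixproj rho1 m v1))).
have W1_inj m : injective (W1 m).
  move=> x y xy; apply: inner_inj => z.
  by rewrite -!((W1i.1 m).1 _ z) xy.
have tilde1 (rho : unitaryRep R) m n (y : rspace (tilde rho) n) :
    rop (tilde rho) (mor_of n m 1%g) y = fixproj rho m (cval y).
  by rewrite (tildeE _ (mor_self n m 1%g)) trisym_of_G1 uact1.
have uc m n : (m <= n)%N -> rop T (mor_of n m 1%g) (u n) = u m.
  by move=> mn; apply: W1_inj; rewrite W1i.2 !uE tilde1 proj_proj.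
have [||v2 [v2E _]] := @fixed_thread_cvg _ rho2 (fun m => W2 m (u m)) (rnorm v1).
- by move=> m n mn; rewrite -tilde1 -W2i.2 uc.
- move=> m; rewrite -lecR -rnormE -[`|_|]/`|W2 m (u m)| (unitary_norm _ (W2i.1 m)).
  rewrite -(unitary_norm _ (W1i.1 m)) uE -[`|_|]/`|cval (fixproj rho1 m v1)|.
  by rewrite rnormE lecR rnorm_proj_le.
by exists v2 => m; exists (u m); rewrite uE v2E.
Qed.

End TwoRepresentations.

Lemma compatible_sym rho1 rho2 W1 W2 v1 v2 :
  @compatible rho1 rho2 W1 W2 v1 v2 -> @compatible rho2 rho1 W2 W1 v2 v1.
Proof. by move=> v12 m; have [u [? ?]] := v12 m; exists u. Qed.

Lemma tilde_unique (rho1 rho2 : unitaryRep R) :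
  catRep_equiv T (tilde rho1) -> catRep_equiv T (tilde rho2) ->
  unitaryRep_equiv rho1 rho2.
Proof.
move=> [W1 W1i] [W2 W2i].
have norm_eq v1 v2 : compatible W1 W2 v1 v2 -> rnorm v1 = rnorm v2.
  move=> v12; apply/eqP; rewrite eq_le (compatible_norm_le W1i W2i v12) /=.
  by apply: (compatible_norm_le W2i W1i); exact: compatible_sym.
have fun_eq v a b : compatible W1 W2 v a -> compatible W1 W2 v b -> a = b.
  move=> va vb; have := norm_eq _ _ (compatible_linear (-1) va vb).
  rewrite !scaleN1r addNr rnorm0 => /esym /rnorm_eq0 /eqP.
  by rewrite addrC subr_eq0 => /eqP.
pose U v := sval (cid (compatible_total W1i W2i v)).
have UP v : compatible W1 W2 v (U v) := svalP (cid (compatible_total W1i W2i v)).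
have Ulin : linear U.
  by move=> a v w; apply: fun_eq (UP _) _; exact: compatible_linear.
pose Um := GRing.isLinear.Build _ _ _ _ U Ulin.
pose UL : {linear uspace rho1 -> uspace rho2} := HB.pack U Um.
exists UL; split; last first.
  by move=> g v; apply: fun_eq (UP _) _; exact: compatible_act.
split; first by apply: isometry_inner => v; exact/esym/norm_eq/UP.
move=> y; have [x yx] := compatible_total W2i W1i y; exists x.
exact: fun_eq (UP x) (compatible_sym yx).
Qed.

End Uniqueness.

Theorem theorem3p11 (R : realType) (T : catRep R) (hT : star_representation T) :
  (exists rho : unitaryRep R, catRep_equiv T (tilde rho)) /\
  (forall rho1 rho2 : unitaryRep R,
     catRep_equiv T (tilde rho1) -> catRep_equiv T (tilde rho2) ->
     unitaryRep_equiv rho1 rho2).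
Proof.
split; first by exists (limit_rep hT); exact: limit_rep_equiv.
by move=> rho1 rho2; exact: tilde_unique.
Qed.
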